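(* For every $\alpha\in(0,1]$ and every real $x\neq 0$, the mapping $$\beta\mapsto \Gamma(\beta)\,E_{\alpha,\beta}\!\left(\frac{\Gamma(\beta+\alpha)}{\Gamma(\beta)}\,x\right)$$ is increasing on $(\alpha,\infty)$. Moreover, as $\beta\to\infty$ it converges to $\infty$ if $x\ge 1$ and to $1/(1-x)$ if $x<1$.
   Context: For $\alpha,\beta>0$, $E_{\alpha,\beta}$ denotes the two-parameter Mittag-Leffler function $E_{\alpha,\beta}(z)=\sum_{n\ge 0}\frac{z^n}{\Gamma(\beta+\alpha n)}$, where $\Gamma$ is the Gamma function. *)

(* Defs.v *)
From Stdlib Require Import Reals.
From Coquelicot Require Import Coquelicot.
Open Scope R_scope.

Definition Gamma (b : R) : R :=
  RInt_gen (fun t => Rpower t (b - 1) * exp (- t))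
           (at_right 0) (Rbar_locally p_infty).

Definition ML (a b z : R) : R :=
  Series (fun n : nat => z ^ n / Gamma (b + a * INR n)).

(* Main.v *)
Require Import Defs.
From Stdlib Require Import Reals Lra Lia.
From Coquelicot Require Import Coquelicot.
Open Scope R_scope.

(** Write the function as the entire series [sum c_n(b) x^n] with
    [c_n(b) = Gamma b / Gamma (b + a n) * (Gamma (b + a) / Gamma b)^n].

    Monotonicity in [b].  The functional equation gives [c_n(b) = phi_n(b) c_n(b + 1)] with
    [phi_n(s) = (1 + a n / s) rho^n], [rho = s / (s + a)], and [c_n(b) -> 1] as [b] grows.  Hence
    [c(b1)] is carried to [c(b2)] by replacing, successively for [k = 0, 1, ...], the factor
    [phi_n(b1 + k)] by [phi_n(b2 + k)].  Removing the factor [phi_n(s)] from a series leaves a series [h],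
    and putting it back gives [h(rho x) + (1 - rho) x h'(rho x)], the tangent of [h] at [rho x] evaluated
    at [x]; since [rho] increases with [s], each replacement increases the value when [h] is convex.
    Dividing coefficients by [s + a n] preserves convexity, so that it suffices that [E_{a,b}] is convex on
    the real line for [b > a].

    Convexity of [E_{a,b}] on the negative half-line.  The coefficient of [s^N] in
    [(1 - s)^(-(b-a)) ((1 - s)^a + mu)^(-m)] is nonnegative for [mu >= 0], since [1 - (1 - s)^a] has
    nonnegative coefficients when [0 < a <= 1].  Expanding in powers of [mu], putting [mu = y / N^a] and letting
    [N] tend to infinity, Gauss's product formula turns it into a positive multiple of the derivative of
    order [m - 1] of [E_{a,b}] at [- y].

    Limits.  For [x > 0] they follow from [0 < c_n(b) <= 1] and [c_n(b) -> 1].  For [x < 0], the identity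
    [F(b, x) = 1 + x F(b + a, r x)] with [r = c_2(b)], together with the monotonicity in [b] and in [x], gives
    [1 / (1 - x / r) <= F(b + a, x) <= 1 / (1 - x)]. *)

(** * Euler's integral and the logarithmic convexity of the Gamma function *)

Definition gamma_integrand (b t : R) : R := Rpower t (b - 1) * exp (- t).

Lemma Rpower_pos x y : 0 < Rpower x y.
Proof. apply exp_pos. Qed.

Lemma gamma_integrand_pos b t : 0 < gamma_integrand b t.
Proof. apply Rmult_lt_0_compat; apply exp_pos. Qed.

Lemma is_derive_Rpower c t : 0 < t ->
  is_derive (fun t => Rpower t c) t (c * Rpower t (c - 1)).
Proof.
  intros ht. apply is_derive_Reals. apply derivable_pt_lim_power. exact ht.
Qed.

Lemma gamma_integrand_continuous b t : 0 < t -> continuous (gamma_integrand b) t.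
Proof.
  intros ht. apply (ex_derive_continuous (gamma_integrand b)).
  exists ((b - 1) * Rpower t (b - 1 - 1) * exp (- t) + Rpower t (b - 1) * (- exp (- t))).
  unfold gamma_integrand. apply (is_derive_mult (fun t => Rpower t (b - 1)) (fun t => exp (- t))).
  - now apply is_derive_Rpower.
  - auto_derive; [exact I|ring].
  - intros; apply Rmult_comm.
Qed.

Lemma gamma_integrand_ex_RInt b u v : 0 < u -> 0 < v -> ex_RInt (gamma_integrand b) u v.
Proof.
  intros hu hv. apply (ex_RInt_continuous (gamma_integrand b)). intros z [hz _].
  apply gamma_integrand_continuous. apply Rlt_le_trans with (2 := hz). now apply Rmin_glb_lt.
Qed.

(** Multiplying [ln (t / c) <= t / c - 1] by [c] gives [c * ln t <= c * ln c + t - c], and the last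
    term is dropped. *)
Lemma Rpower_le_exp c t : 0 < c -> 0 < t -> Rpower t c <= Rpower c c * exp t.
Proof.
  intros hc ht. unfold Rpower. rewrite <- exp_plus.
  assert (ln (t / c) <= t / c - 1).
  { assert (h := exp_ineq1_le (ln (t / c))). rewrite exp_ln in h. lra.
    now apply Rdiv_lt_0_compat. }
  rewrite ln_div in H by lra.
  assert (c * (ln t - ln c) <= c * (t / c - 1)) by (apply Rmult_le_compat_l; lra).
  replace (c * (t / c - 1)) with (t - c) in H0 by (field; lra).
  destruct (Req_dec (c * ln t) (c * ln c + t)) as [->|]. lra.
  left. apply exp_increasing. lra.
Qed.

(* [gamma_integrand b] is dominated by a multiple of the derivative of
   [- 1 / (1 + t^b)], whose total variation is finite. *)
Lemma gamma_integrand_bounded b : 0 < b ->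
  exists M, forall u v, 0 < u -> u < v -> RInt (gamma_integrand b) u v <= M.
Proof.
  intros hb.
  (* The square [(1 + t^b)^2] is at most [4] when [t^b <= 1] and at most [4 * t^(2b)] otherwise,
     which [Rpower_le_exp] absorbs into [exp t]; [C] adds the two constants. *)
  set (C := 4 + 4 * Rpower (2 * b) (2 * b)).
  assert (hC : 0 < C) by (unfold C; assert (h := Rpower_pos (2 * b) (2 * b)); lra).
  assert (hd : forall t, 0 < t -> (1 + Rpower t b) ^ 2 * exp (- t) <= C).
  { intros t ht.
    assert (h2 : (1 + Rpower t b) ^ 2 <= C * exp t).
    { assert (he : 1 <= exp t) by (assert (h := exp_ineq1_le t); lra).
      assert (hp := Rpower_pos t b).
      assert (hq := Rpower_pos (2 * b) (2 * b)).
      assert (hl : Rpower t (2 * b) <= Rpower (2 * b) (2 * b) * exp t)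
        by (apply Rpower_le_exp; lra).
      replace (2 * b) with (b + b) in hl at 1 by ring. rewrite Rpower_plus in hl.
      destruct (Rle_lt_dec (Rpower t b) 1); unfold C; nra. }
    rewrite exp_Ropp. assert (0 < exp t) by apply exp_pos.
    apply Rmult_le_reg_r with (exp t); [assumption|].
    rewrite Rmult_assoc, Rinv_l by lra. lra. }
  exists (C / b).
  intros u v hu huv.
  set (P := fun t => - (C / b) / (1 + Rpower t b)).
  set (P' := fun t => C * Rpower t (b - 1) / (1 + Rpower t b) ^ 2).
  assert (hP : is_RInt P' u v (minus (P v) (P u))).
  { apply (is_RInt_derive P P').
    - intros t ht. rewrite Rmin_left, Rmax_right in ht by lra.
      assert (0 < Rpower t b) by apply Rpower_pos.
      unfold P, P'.
      apply (is_derive_ext (fun t => scal (- (C / b)) (/ (1 + Rpower t b)))).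
      { intros; reflexivity. }
      replace (C * Rpower t (b - 1) / (1 + Rpower t b) ^ 2) with
       (scal (- (C / b)) (- (b * Rpower t (b - 1)) / (1 + Rpower t b) ^ 2))
       by (unfold scal; simpl; unfold mult; simpl; field; lra).
      apply is_derive_scal. apply (is_derive_inv (fun t => 1 + Rpower t b)); [|lra].
      replace (b * Rpower t (b - 1)) with (plus 0 (b * Rpower t (b - 1)))
        by (unfold plus; simpl; ring).
      apply (is_derive_plus (fun _ => 1) (fun t => Rpower t b)).
      { auto_derive; [exact I|reflexivity]. }
      apply is_derive_Rpower; lra.
    - intros t ht. rewrite Rmin_left, Rmax_right in ht by lra.
      assert (0 < Rpower t b) by apply Rpower_pos.
      unfold P'. apply (ex_derive_continuous (fun t => C * Rpower t (b - 1) / (1 + Rpower t b) ^ 2)).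
      assert (ex_derive (fun t => Rpower t (b - 1)) t).
      { eexists; apply is_derive_Rpower; lra. }
      assert (ex_derive (fun t => Rpower t b) t).
      { eexists; apply is_derive_Rpower; lra. }
      auto_derive. repeat split; auto.  nra. }
  apply Rle_trans with (RInt P' u v).
  - apply RInt_le; [lra| | |].
    + apply gamma_integrand_ex_RInt; lra.
    + eexists; exact hP.
    + intros t ht. unfold gamma_integrand, P', Rdiv.
      rewrite (Rmult_comm C), Rmult_assoc.
      apply Rmult_le_compat_l; [left; apply Rpower_pos|].
      assert (0 < Rpower t b) by apply Rpower_pos.
      assert (0 < (1 + Rpower t b) ^ 2) by nra.
      apply Rmult_le_reg_l with ((1 + Rpower t b) ^ 2); [assumption|].
      replace ((1 + Rpower t b) ^ 2 * (C * / (1 + Rpower t b) ^ 2)) with C by (field; lra).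
      apply hd; lra.
  - rewrite (is_RInt_unique _ _ _ _ hP). unfold minus, plus, opp, P; simpl.
    assert (hu' := Rpower_pos u b). assert (hv' := Rpower_pos v b).
    assert (0 < C / b) by (now apply Rdiv_lt_0_compat).
    assert (0 < C / b / (1 + Rpower v b)) by (apply Rdiv_lt_0_compat; lra).
    assert (C / b / (1 + Rpower u b) <= C / b).
    { apply Rmult_le_reg_r with (1 + Rpower u b); [lra|].
      unfold Rdiv at 1. rewrite Rmult_assoc, Rinv_l by lra. nra. }
    unfold Rdiv in *. lra.
Qed.

Lemma gamma_integrand_RInt_mono b u v u' v' : 0 < u' -> u' <= u -> u < v -> v <= v' ->
  RInt (gamma_integrand b) u v <= RInt (gamma_integrand b) u' v'.
Proof.
  intros.
  rewrite <- (RInt_Chasles (gamma_integrand b) u' u v') by (apply gamma_integrand_ex_RInt; lra).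
  rewrite <- (RInt_Chasles (gamma_integrand b) u v v') by (apply gamma_integrand_ex_RInt; lra).
  assert (0 <= RInt (gamma_integrand b) u' u)
    by (apply RInt_ge_0; [lra|apply gamma_integrand_ex_RInt; lra|intros; left; apply gamma_integrand_pos]).
  assert (0 <= RInt (gamma_integrand b) v v')
    by (apply RInt_ge_0; [lra|apply gamma_integrand_ex_RInt; lra|intros; left; apply gamma_integrand_pos]).
  unfold plus; simpl. lra.
Qed.

(** The integrand is positive, so its integrals grow with the interval; being bounded, they converge
    to their supremum. The supremum form lets bounds on proper integrals pass to [Gamma]. *)
Lemma Gamma_spec b : 0 < b ->
  is_RInt_gen (gamma_integrand b) (at_right 0) (Rbar_locally p_infty) (Gamma b) /\
  is_lub (fun z => exists u v, 0 < u /\ u < v /\ z = RInt (gamma_integrand b) u v) (Gamma b).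
Proof.
  intros hb.
  destruct (gamma_integrand_bounded b hb) as [M hM].
  destruct (completeness (fun z => exists u v, 0 < u /\ u < v /\ z = RInt (gamma_integrand b) u v))
    as [S hS].
  - exists M. intros z (u & v & h1 & h2 & ->). auto.
  - exists (RInt (gamma_integrand b) 1 2), 1, 2. repeat split; lra.
  - assert (hG : is_RInt_gen (gamma_integrand b) (at_right 0) (Rbar_locally p_infty) S).
    { intros Q [eps hQ].
      destruct (Classical_Prop.classic
        (exists u v, 0 < u /\ u < v /\ S - eps < RInt (gamma_integrand b) u v)) as [(u & v & h1 & h2 & h3)|hn].
      - exists (fun x => 0 < x < u) (fun y => v < y).
        + exists (mkposreal u h1). intros y hy hy0. split; [exact hy0|].
          apply Rabs_lt_between in hy. unfold minus, plus, opp in hy; simpl in hy. lra.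
        + exists v; auto.
        + intros x y hx hy. exists (RInt (gamma_integrand b) x y). split.
          * apply (RInt_correct (gamma_integrand b)). apply gamma_integrand_ex_RInt; simpl; lra.
          * apply hQ. apply Rabs_lt_between. unfold minus, plus, opp; simpl.
            assert (RInt (gamma_integrand b) u v <= RInt (gamma_integrand b) x y)
              by (apply gamma_integrand_RInt_mono; lra).
            assert (RInt (gamma_integrand b) x y <= S).
            { apply (proj1 hS). exists x, y. repeat split; lra. }
            assert (he := cond_pos eps). lra.
      - exfalso. assert (S <= S - eps).
        { apply (proj2 hS). intros z (u & v & h1 & h2 & ->).
          destruct (Rle_lt_dec (RInt (gamma_integrand b) u v) (S - eps)); auto.
          exfalso; apply hn; exists u, v; auto. }
        assert (he := cond_pos eps). lra. }
    assert (Gamma b = S) as ->.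
    { unfold Gamma. apply is_RInt_gen_unique. exact hG. }
    auto.
Qed.

Lemma Gamma_pos b : 0 < b -> 0 < Gamma b.
Proof.
  intros hb. destruct (Gamma_spec b hb) as [_ [hub _]].
  apply Rlt_le_trans with (RInt (gamma_integrand b) 1 2).
  - apply RInt_gt_0; [lra| |].
    + intros; apply gamma_integrand_pos.
    + intros; apply gamma_integrand_continuous; lra.
  - apply hub. exists 1, 2; repeat split; lra.
Qed.

Lemma ln_le_sub1 x : 0 < x -> ln x <= x - 1.
Proof.
  intros hx. assert (h := exp_ineq1_le (ln x)). rewrite exp_ln in h; lra.
Qed.

(** The bound [ln r <= r - 1] is applied to [X / m] and [Y / m], with [m] the weighted mean; the
    weighted sum of the right-hand sides is zero. *)
Lemma weighted_AMGM X Y th : 0 < X -> 0 < Y -> 0 <= th <= 1 ->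
  Rpower X th * Rpower Y (1 - th) <= th * X + (1 - th) * Y.
Proof.
  intros hX hY ht.
  set (m := th * X + (1 - th) * Y).
  assert (hm : 0 < m).
  { unfold m. destruct (Rle_lt_dec th (1 / 2)); nra. }
  assert (h1 := ln_le_sub1 (X / m) ltac:(now apply Rdiv_lt_0_compat)).
  assert (h2 := ln_le_sub1 (Y / m) ltac:(now apply Rdiv_lt_0_compat)).
  rewrite ln_div in h1, h2 by assumption.
  assert (e : th * (X / m - 1) + (1 - th) * (Y / m - 1) = 0)
    by (unfold m; field; fold m; lra).
  unfold Rpower. rewrite <- exp_plus, <- (exp_ln m) by assumption.
  assert (th * ln X + (1 - th) * ln Y <= ln m) by nra.
  destruct H as [H|H]; [left; now apply exp_increasing|right; now rewrite H].
Qed.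

(** Hölder's inequality for Euler's integral: on each compact interval, the weighted
    arithmetic-geometric mean inequality is integrated for the integrands divided by [Gamma u] and
    [Gamma v]. *)
Lemma Gamma_log_convex u v th : 0 < u -> 0 < v -> 0 <= th <= 1 ->
  Gamma (th * u + (1 - th) * v) <= Rpower (Gamma u) th * Rpower (Gamma v) (1 - th).
Proof.
  intros hu hv ht.
  assert (hw : 0 < th * u + (1 - th) * v) by (destruct (Rle_lt_dec th (1 / 2)); nra).
  assert (gu := Gamma_pos u hu). assert (gv := Gamma_pos v hv).
  apply (proj2 (proj2 (Gamma_spec _ hw))).
  intros z (x & y & hx & hxy & ->).
  set (K := Rpower (Gamma u) th * Rpower (Gamma v) (1 - th)).
  assert (hK : 0 < K) by (apply Rmult_lt_0_compat; apply Rpower_pos).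
  assert (eu := gamma_integrand_ex_RInt u x y hx ltac:(lra)).
  assert (ev := gamma_integrand_ex_RInt v x y hx ltac:(lra)).
  set (g := fun t => plus (scal (K * th / Gamma u) (gamma_integrand u t))
                         (scal (K * (1 - th) / Gamma v) (gamma_integrand v t))).
  assert (hg : is_RInt g x y (plus (scal (K * th / Gamma u) (RInt (gamma_integrand u) x y))
                                   (scal (K * (1 - th) / Gamma v) (RInt (gamma_integrand v) x y)))).
  { apply (is_RInt_plus (V := R_NormedModule)); apply (is_RInt_scal (V := R_NormedModule));
    now apply (RInt_correct (V := R_CompleteNormedModule)). }
  apply Rle_trans with (RInt g x y).
  - apply RInt_le; [lra|apply gamma_integrand_ex_RInt; lra|eexists; exact hg|].
    intros t htt. unfold g, plus, scal; simpl; unfold mult; simpl.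
    assert (h := weighted_AMGM (gamma_integrand u t / Gamma u) (gamma_integrand v t / Gamma v) th
       ltac:(apply Rdiv_lt_0_compat; [apply gamma_integrand_pos|assumption])
       ltac:(apply Rdiv_lt_0_compat; [apply gamma_integrand_pos|assumption]) ht).
    apply (Rmult_le_compat_l K) in h; [|lra].
    eapply Rle_trans; [|eapply Rle_trans; [exact h|]].
    + right. unfold K, gamma_integrand, Rpower.
      rewrite <- !exp_plus. f_equal.
      rewrite !ln_div by (try apply Rmult_lt_0_compat; try apply exp_pos; assumption).
      rewrite !ln_exp. ring.
    + right. field. lra.
  - rewrite (is_RInt_unique _ _ _ _ hg). unfold plus, scal; simpl; unfold mult; simpl.
    assert (iu : RInt (gamma_integrand u) x y <= Gamma u).
    { apply (proj1 (proj2 (Gamma_spec u hu))). exists x, y; auto. }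
    assert (iv : RInt (gamma_integrand v) x y <= Gamma v).
    { apply (proj1 (proj2 (Gamma_spec v hv))). exists x, y; auto. }
    replace K with (K * th / Gamma u * Gamma u + K * (1 - th) / Gamma v * Gamma v) at 3
      by (field; lra).
    apply Rplus_le_compat; apply Rmult_le_compat_l; try assumption;
    (apply Rmult_le_pos; [apply Rmult_le_pos; lra|left; now apply Rinv_0_lt_compat]).
Qed.

Lemma Rpower_lim_0 b : 0 < b -> filterlim (fun t => Rpower t b) (at_right 0) (locally 0).
Proof.
  intros hb. apply filterlim_locally. intros eps.
  exists (mkposreal _ (Rpower_pos eps (/ b))). intros t ht ht0.
  apply Rabs_lt_between in ht. unfold minus, plus, opp in ht; simpl in ht.
  apply Rabs_lt_between. unfold minus, plus, opp; simpl.
  assert (hp := Rpower_pos t b). assert (he := cond_pos eps).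
  assert (Rpower t b < eps); [|lra].
  replace (pos eps) with (Rpower (Rpower eps (/ b)) b).
  - apply Rlt_Rpower_l; lra.
  - rewrite Rpower_mult, Rinv_l, Rpower_1; lra.
Qed.

Lemma gamma_integrand_lim_p b : 0 < b ->
  filterlim (fun t => Rpower t b * exp (- t)) (Rbar_locally p_infty) (locally 0).
Proof.
  intros hb. apply filterlim_locally. intros eps.
  set (K := Rpower (b + 1) (b + 1)).
  assert (hK : 0 < K) by apply Rpower_pos.
  assert (he := cond_pos eps).
  exists (K / eps). intros t ht.
  assert (0 < K / eps) by now apply Rdiv_lt_0_compat.
  apply Rabs_lt_between. unfold minus, plus, opp; simpl.
  assert (hp : 0 < Rpower t b * exp (- t)) by (apply Rmult_lt_0_compat; apply exp_pos).
  assert (h := Rpower_le_exp (b + 1) t ltac:(lra) ltac:(lra)). fold K in h.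
  rewrite Rpower_plus, Rpower_1 in h by lra.
  assert (K < eps * t).
  { apply (Rmult_lt_compat_r eps) in ht; [|lra]. unfold Rdiv in ht.
    rewrite Rmult_assoc, Rinv_l in ht by lra. lra. }
  assert (Rpower t b * exp (- t) < eps); [|lra].
  assert (hq := exp_pos t).
  rewrite exp_Ropp. apply Rmult_lt_reg_r with (exp t); [assumption|].
  rewrite Rmult_assoc, Rinv_l, Rmult_1_r by lra.
  apply Rmult_lt_reg_r with t; [lra|]. nra.
Qed.

(** Integration by parts: the boundary term [t^b * exp (- t)] vanishes at both ends of the
    half-line. *)
Lemma Gamma_succ b : 0 < b -> Gamma (b + 1) = b * Gamma b.
Proof.
  intros hb.
  set (P := fun t => Rpower t b * exp (- t)).
  assert (hP : forall t, 0 < t -> is_derive P t (b * gamma_integrand b t - gamma_integrand (b + 1) t)).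
  { intros t ht.
    replace (b * gamma_integrand b t - gamma_integrand (b + 1) t) with
      ((b * Rpower t (b - 1)) * exp (- t) + Rpower t b * (- exp (- t))).
    - apply (is_derive_mult (fun t => Rpower t b) (fun t => exp (- t))).
      + now apply is_derive_Rpower.
      + auto_derive; [exact I|ring].
      + intros; apply Rmult_comm.
    - unfold gamma_integrand. replace (b + 1 - 1) with b by ring. ring. }
  assert (hd : is_RInt_gen (Derive P) (at_right 0) (Rbar_locally p_infty) (0 - 0)).
  (* The derivative formula holds for positive arguments; both filters eventually keep the interval
     of integration inside the positive half-line. *)
  { assert (hf : forall Q : R -> Prop, (forall t, 0 < t -> Q t) ->
      filter_prod (at_right 0) (Rbar_locally p_infty)
        (fun ab : R * R => forall x, Rmin (fst ab) (snd ab) <= x <= Rmax (fst ab) (snd ab) -> Q x)).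
    { intros Q hQ. exists (fun x => 0 < x) (fun x => 0 < x).
      - exists (mkposreal 1 Rlt_0_1). auto.
      - exists 0; auto.
      - intros x y hx hy z [hz _]. simpl in hz. apply hQ.
        apply Rlt_le_trans with (2 := hz). now apply Rmin_glb_lt. }
    apply is_RInt_gen_Derive.
    - apply hf. intros t ht. eexists; now apply hP.
    - apply hf. intros t ht.
      apply (continuous_ext_loc (Derive P) (fun t => b * gamma_integrand b t - gamma_integrand (b + 1) t)).
      + exists (mkposreal t ht). intros y hy.
        apply Rabs_lt_between in hy. unfold minus, plus, opp in hy; simpl in hy.
        symmetry. apply is_derive_unique, hP. lra.
      + apply (continuous_minus (V := R_NormedModule) (fun t => b * gamma_integrand b t)).
        * apply (continuous_scal_r b (gamma_integrand b)). now apply gamma_integrand_continuous.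
        * now apply gamma_integrand_continuous.
    - replace 0 with (mult 0 1) at 2 by apply Rmult_0_l.
      apply (filterlim_comp_2 (G := locally 0) (H := locally 1)
         (fun t => Rpower t b) (fun t => exp (- t)) mult).
      + now apply Rpower_lim_0.
      + assert (hc : continuous (fun t => exp (- t)) 0).
        { apply (ex_derive_continuous (fun t => exp (- t))). auto_derive. exact I. }
        intros Q hQ. unfold filtermap, at_right, within.
        apply filter_imp with (fun t => Q (exp (- t))); [auto|].
        apply (hc Q). now rewrite Ropp_0, exp_0.
      + apply (filterlim_mult (K := R_AbsRing)).
    - now apply gamma_integrand_lim_p. }
  destruct (Gamma_spec b hb) as [h1 _].
  assert (h3 := is_RInt_gen_minus _ _ _ _ (is_RInt_gen_scal _ b _ h1) hd).
  unfold Gamma at 1. apply is_RInt_gen_unique.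
  replace (b * Gamma b) with (minus (scal b (Gamma b)) (0 - 0))
    by (unfold minus, plus, opp, scal; simpl; unfold mult; simpl; ring).
  refine (is_RInt_gen_ext _ _ _ _ h3).
  exists (fun x => 0 < x) (fun x => 0 < x).
  - exists (mkposreal 1 Rlt_0_1). auto.
  - exists 0; auto.
  - intros x y hx hy z [hz _]. simpl in hz.
    assert (0 < z) by (apply Rlt_trans with (2 := hz); now apply Rmin_glb_lt).
    rewrite (is_derive_unique _ _ _ (hP z H)).
    unfold minus, plus, opp, scal; simpl; unfold mult; simpl.
    fold (gamma_integrand (b + 1) z). ring.
Qed.

(** Logarithmic convexity at [t], between [t - 1] and [t + c], reads [Gamma(t)^(1+c) <= Gamma(t-1)^c
    * Gamma(t+c)]. Inserting [Gamma t = (t - 1) * Gamma (t - 1)] and cancelling [Gamma(t-1)^c]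
    leaves the bound. *)
Lemma Gamma_ratio_lower t c : 1 < t -> 0 < c -> Rpower (t - 1) c * Gamma t <= Gamma (t + c).
Proof.
  intros ht hc.
  assert (g0 := Gamma_pos (t - 1) ltac:(lra)).
  assert (g1 := Gamma_pos t ltac:(lra)).
  assert (g2 := Gamma_pos (t + c) ltac:(lra)).
  assert (e := Gamma_succ (t - 1) ltac:(lra)). replace (t - 1 + 1) with t in e by ring.
  assert (hth : 0 <= c / (1 + c) <= 1).
  { split; [apply Rdiv_le_0_compat; lra|]. apply Rmult_le_reg_r with (1 + c); [lra|].
    unfold Rdiv. rewrite Rmult_assoc, Rinv_l; lra. }
  assert (h := Gamma_log_convex (t - 1) (t + c) (c / (1 + c)) ltac:(lra) ltac:(lra) hth).
  replace (c / (1 + c) * (t - 1) + (1 - c / (1 + c)) * (t + c)) with t in h by (field; lra).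
  assert (hc1 : 0 <= 1 + c) by lra.
  apply (fun h => Rle_Rpower_l _ _ _ hc1 (conj g1 h)) in h.
  rewrite <- Rpower_mult_distr in h by apply Rpower_pos.
  rewrite !Rpower_mult in h.
  replace (c / (1 + c) * (1 + c)) with c in h by (field; lra).
  replace ((1 - c / (1 + c)) * (1 + c)) with 1 in h by (field; lra).
  rewrite (Rpower_1 (Gamma (t + c))), Rpower_plus, Rpower_1 in h by lra.
  rewrite e in h at 2. rewrite <- Rpower_mult_distr in h by lra.
  assert (hp := Rpower_pos (Gamma (t - 1)) c).
  apply Rmult_le_reg_l with (1 := hp). lra.
Qed.

(** The same argument at [t + c], between [t] and [t + c + 1]: [Gamma(t+c)^(1+c) <= Gamma(t) *
    Gamma(t+c+1)^c]. *)
Lemma Gamma_ratio_upper t c : 0 < t -> 0 < c -> Gamma (t + c) <= Rpower (t + c) c * Gamma t.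
Proof.
  intros ht hc.
  assert (g1 := Gamma_pos t ltac:(lra)).
  assert (g2 := Gamma_pos (t + c) ltac:(lra)).
  assert (e := Gamma_succ (t + c) ltac:(lra)).
  assert (hth : 0 <= / (1 + c) <= 1).
  { split; [left; apply Rinv_0_lt_compat; lra|]. apply Rmult_le_reg_r with (1 + c); [lra|].
    rewrite Rinv_l; lra. }
  assert (h := Gamma_log_convex t (t + c + 1) (/ (1 + c)) ltac:(lra) ltac:(lra) hth).
  replace (/ (1 + c) * t + (1 - / (1 + c)) * (t + c + 1)) with (t + c) in h by (field; lra).
  assert (hc1 : 0 <= 1 + c) by lra.
  apply (fun h => Rle_Rpower_l _ _ _ hc1 (conj g2 h)) in h.
  rewrite <- Rpower_mult_distr in h by apply Rpower_pos.
  rewrite !Rpower_mult in h.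
  replace (/ (1 + c) * (1 + c)) with 1 in h by (field; lra).
  replace ((1 - / (1 + c)) * (1 + c)) with c in h by (field; lra).
  rewrite e, Rpower_plus, !Rpower_1, <- Rpower_mult_distr in h by lra.
  assert (hp := Rpower_pos (Gamma (t + c)) c).
  apply Rmult_le_reg_l with (1 := hp). lra.
Qed.

(** * The coefficients of [(1-s)^(-c) ((1-s)^a + mu)^(-m)] *)

Lemma filterlim_sum_f_R0 {T} (F : (T -> Prop) -> Prop) {FF : Filter F}
  (u : T -> nat -> R) (l : nat -> R) K :
  (forall n, filterlim (fun k => u k n) F (locally (l n))) ->
  filterlim (fun k => sum_f_R0 (u k) K) F (locally (sum_f_R0 l K)).
Proof.
  intros h. induction K as [|K IH]; simpl; [apply h|].
  apply (filterlim_comp_2 _ _ Rplus IH (h (S K))).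
  apply (filterlim_plus (V := R_NormedModule)).
Qed.

(** Tannery's theorem along a filter. An index [K] is chosen where the tail of [M] is below
    [eps / 4]; the two tails and the difference of the partial sums then cost at most [eps / 4]
    each. *)
Lemma Series_dominated_lim {T} (F : (T -> Prop) -> Prop) {FF : Filter F}
  (u : T -> nat -> R) (l M : nat -> R) :
  ex_series M ->
  F (fun k => forall n, Rabs (u k n) <= M n) ->
  (forall n, Rabs (l n) <= M n) ->
  (forall n, filterlim (fun k => u k n) F (locally (l n))) ->
  filterlim (fun k => Series (u k)) F (locally (Series l)).
Proof.
  intros hM hu hl h. apply filterlim_locally. intros eps.
  assert (he := cond_pos eps).
  assert (hs := Series_correct M hM).
  destruct (proj1 (filterlim_locally _ _) hs (mkposreal (eps / 4) ltac:(lra))) as [K hK].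
  specialize (hK K (le_n K)). apply Rabs_lt_between in hK.
  unfold minus, plus, opp in hK; simpl in hK. rewrite sum_n_Reals in hK.
  assert (hT := Series_incr_n M (S K) ltac:(lia) hM). simpl Nat.pred in hT.
  assert (exl : forall v, (forall n, Rabs (v n) <= M n) -> ex_series v).
  { intros v hv. apply (ex_series_le v M); assumption. }
  assert (tail : forall v, (forall n, Rabs (v n) <= M n) ->
     Rabs (Series v - sum_f_R0 v K) <= eps / 4).
  { intros v hv. rewrite (Series_incr_n v (S K) ltac:(lia) (exl v hv)). simpl Nat.pred.
    set (s := sum_f_R0 v K).
    replace (s + Series (fun k => v (S K + k)%nat) - s) with (Series (fun k => v (S K + k)%nat)) by ring.
    assert (hM' : ex_series (fun k => M (S K + k)%nat)) by now apply ex_series_incr_n.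
    assert (hv' : ex_series (fun k => Rabs (v (S K + k)%nat))).
    { apply (ex_series_le (V := R_CompleteNormedModule) _ (fun k => M (S K + k)%nat)); [|exact hM'].
      intros n. unfold norm; simpl; unfold abs; simpl. rewrite Rabs_Rabsolu. apply hv. }
    apply Rle_trans with (1 := Series_Rabs _ hv').
    apply Rle_trans with (Series (fun k => M (S K + k)%nat)); [|lra].
    apply Series_le; [|exact hM']. intros n. split; [apply Rabs_pos|apply hv]. }
  assert (hf := proj1 (filterlim_locally _ _) (filterlim_sum_f_R0 F u l K h)
     (mkposreal (eps / 4) ltac:(lra))).
  generalize (filter_and _ _ hu hf). apply filter_imp. intros k [h1 h2].
  apply Rabs_lt_between in h2. unfold minus, plus, opp in h2; simpl in h2.
  assert (t1 := tail _ h1). assert (t2 := tail _ hl).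
  apply Rabs_le_between in t1. apply Rabs_le_between in t2.
  apply Rabs_lt_between. unfold minus, plus, opp; simpl. lra.
Qed.

(* Coefficient of [s^N] in [(1 - s)^(-t)]. *)
Fixpoint rising_bin (t : R) (N : nat) : R :=
  match N with O => 1 | S N' => rising_bin t N' * (t + INR N') / INR (S N') end.

Lemma rising_bin_S t N : INR (S N) * rising_bin t (S N) = (t + INR N) * rising_bin t N.
Proof. assert (h := not_0_INR (S N) ltac:(lia)). unfold rising_bin; fold rising_bin. field. exact h. Qed.

(** Coefficient form of the fact that [(1 - s)^(-t)] has derivative [t * (1 - s)^(-t-1)]. *)
Lemma rising_bin_shift t n : INR (S n) * rising_bin t (S n) = t * rising_bin (t + 1) n.
Proof.
  induction n as [|n IH]; [simpl; field|].
  assert (h := not_0_INR (S n) ltac:(lia)).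
  assert (h2 := not_0_INR (S (S n)) ltac:(lia)).
  apply Rmult_eq_reg_l with (INR (S n)); [|assumption].
  rewrite rising_bin_S.
  replace (INR (S n) * (t * rising_bin (t + 1) (S n))) with (t * (INR (S n) * rising_bin (t + 1) (S n))) by ring.
  rewrite rising_bin_S.
  replace (INR (S n) * ((t + INR (S n)) * rising_bin t (S n)))
    with ((t + INR (S n)) * (INR (S n) * rising_bin t (S n))) by ring.
  rewrite IH, S_INR. ring.
Qed.

(** Multiplication of [(1 - s)^(-(t+1))] by [1 - s]. *)
Lemma rising_bin_pascal t n : rising_bin (t + 1) (S n) - rising_bin (t + 1) n = rising_bin t (S n).
Proof.
  assert (h := not_0_INR (S n) ltac:(lia)).
  apply Rmult_eq_reg_l with (INR (S n)); [|assumption].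
  rewrite rising_bin_shift, Rmult_minus_distr_l, rising_bin_S, S_INR. ring.
Qed.

Lemma rising_bin_pos t N : 0 < t -> 0 < rising_bin t N.
Proof.
  intros ht. induction N as [|N IH]; simpl rising_bin; [lra|].
  assert (h := pos_INR N). assert (h2 := lt_0_INR (S N) ltac:(lia)).
  unfold Rdiv. repeat apply Rmult_lt_0_compat; try lra. now apply Rinv_0_lt_compat.
Qed.

Lemma rising_bin_nonneg t N : 0 <= t -> 0 <= rising_bin t N.
Proof.
  intros ht. induction N as [|N IH]; simpl rising_bin; [lra|].
  assert (h := pos_INR N). assert (h2 := lt_0_INR (S N) ltac:(lia)).
  unfold Rdiv. repeat apply Rmult_le_pos; try lra. left; now apply Rinv_0_lt_compat.
Qed.

(** These are the nonconstant coefficients of [(1 - s)^a]: the first is [- a], and each later one is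
    obtained through a factor [- a + N] with [N >= 1], nonnegative since [a <= 1]. *)
Lemma rising_bin_opp_nonpos a N : 0 < a <= 1 -> rising_bin (- a) (S N) <= 0.
Proof.
  intros ha. induction N as [|N IH]; [simpl; lra|].
  assert (h2 := lt_0_INR (S (S N)) ltac:(lia)).
  apply Rmult_le_reg_l with (1 := h2). rewrite rising_bin_S, Rmult_0_r.
  assert (0 <= - a + INR (S N)) by (rewrite S_INR; assert (h := pos_INR N); lra).
  nra.
Qed.

(** Product of [(1 - s)^(-u)] and [(1 - s)^(-v)]. In the induction the factor [S N] is split as
    [j + (S N - j)]; [rising_bin_S] lowers one index in each half, and the halves recombine with the
    factor [u + v + N]. *)
Lemma rising_bin_vandermonde u v N :
  sum_f_R0 (fun j => rising_bin u j * rising_bin v (N - j)) N = rising_bin (u + v) N.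
Proof.
  induction N as [|N IH]; [simpl; ring|].
  assert (h := not_0_INR (S N) ltac:(lia)).
  apply Rmult_eq_reg_l with (INR (S N)); [|assumption].
  rewrite rising_bin_S, <- IH, !scal_sum.
  rewrite (sum_eq _ (fun j => INR j * rising_bin u j * rising_bin v (S N - j)
                     + rising_bin u j * (INR (S N - j) * rising_bin v (S N - j)))).
  2: { intros j hj. rewrite (minus_INR (S N) j) by assumption. ring. }
  rewrite sum_plus.
  rewrite (decomp_sum (fun j => INR j * rising_bin u j * rising_bin v (S N - j))) by lia.
  rewrite (tech5 (fun j => rising_bin u j * (INR (S N - j) * rising_bin v (S N - j)))).
  rewrite Nat.sub_diag. simpl Nat.pred. simpl (INR 0).
  rewrite !Rmult_0_l, Rmult_0_r, Rplus_0_l, Rplus_0_r, <- sum_plus.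
  apply sum_eq. intros j hj. rewrite rising_bin_S.
  rewrite Nat.sub_succ. replace (S N - j)%nat with (S (N - j)) by lia.
  rewrite rising_bin_S, (minus_INR N j) by assumption. ring.
Qed.

Lemma is_lim_seq_affine_inv k r : 0 < r -> is_lim_seq (fun n => k / (r + INR n)) 0.
Proof.
  intros hr.
  replace (Finite 0) with (Rbar_mult k 0) by apply Rbar_mult_0_r.
  apply is_lim_seq_scal_l.
  apply (is_lim_seq_inv _ p_infty); [|discriminate].
  apply is_lim_seq_le_p_loc with INR; [|apply is_lim_seq_INR].
  exists 0%nat. intros; lra.
Qed.

Lemma rising_bin_ratio_lim_index t : 0 < t -> is_lim_seq (fun n => rising_bin t (S n) / rising_bin t n) 1.
Proof.
  intros ht.
  apply is_lim_seq_ext with (fun n => 1 + (t - 1) / (1 + INR n)).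
  - intros n. assert (hp := rising_bin_pos t n ht). simpl rising_bin.
    assert (h2 := lt_0_INR (S n) ltac:(lia)).
    change (match n with O => 1 | S _ => INR n + 1 end) with (INR (S n)).
    rewrite S_INR in *. field. lra.
  - replace (Finite 1) with (Finite (1 + 0)) by (f_equal; ring).
    apply is_lim_seq_plus'. apply is_lim_seq_const.
    apply is_lim_seq_affine_inv; lra.
Qed.

Lemma rising_bin_ratio_lim_arg a t N : 0 < a -> 0 < t ->
  is_lim_seq (fun n => rising_bin (t + a * INR (S n)) N / rising_bin (t + a * INR n) N) 1.
Proof.
  intros ha ht. induction N as [|N IH].
  - simpl rising_bin. apply is_lim_seq_ext with (fun _ => 1); [intros; field|apply is_lim_seq_const].
  - apply is_lim_seq_ext with (fun n =>
      (rising_bin (t + a * INR (S n)) N / rising_bin (t + a * INR n) N) * (1 + 1 / ((t + INR N) / a + INR n))).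
    + intros n. assert (hn := pos_INR n). assert (hN := pos_INR N).
      assert (0 <= a * INR n) by nra.
      assert (hp := rising_bin_pos (t + a * INR n) N ltac:(lra)).
      assert (h2 := not_0_INR (S N) ltac:(lia)).
      unfold rising_bin; fold rising_bin. rewrite !(S_INR n).
      field. repeat split; try assumption; try lra; try nra.
    + replace (Finite 1) with (Finite (1 * (1 + 0))) by (f_equal; ring).
      apply is_lim_seq_mult'; [assumption|]. apply is_lim_seq_plus'; [apply is_lim_seq_const|].
      apply is_lim_seq_affine_inv. apply Rdiv_lt_0_compat; [|assumption].
      assert (hN := pos_INR N). lra.
Qed.

(** Ratio test: for both factors the quotient of consecutive terms tends to 1, which gives
    convergence for [Rabs x < 1]. *)
Lemma rising_bin_ex_series a t m N x : 0 < a -> 0 < t -> 0 < m -> Rabs x < 1 ->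
  ex_series (fun n => Rabs (rising_bin m n * x ^ n * rising_bin (t + a * INR n) N)).
Proof.
  intros ha ht hm hx.
  assert (hpos : forall n, 0 < rising_bin m n * rising_bin (t + a * INR n) N).
  { intros n. assert (hn := pos_INR n). apply Rmult_lt_0_compat; apply rising_bin_pos; nra. }
  assert (h : CV_disk (fun n => rising_bin m n * rising_bin (t + a * INR n) N) x).
  { apply CV_disk_DAlembert with 1.
    - intros n. assert (h := hpos n). lra.
    - apply is_lim_seq_ext with (fun n => (rising_bin m (S n) / rising_bin m n) *
         (rising_bin (t + a * INR (S n)) N / rising_bin (t + a * INR n) N)).
      + intros n. rewrite Rabs_right.
        * assert (hn := pos_INR n).
          assert (h1 := rising_bin_pos m n hm).
          assert (h2 := rising_bin_pos (t + a * INR n) N ltac:(nra)). field. lra.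
        * apply Rle_ge. left. apply Rdiv_lt_0_compat; apply hpos.
      + replace (Finite 1) with (Finite (1 * 1)) by (f_equal; ring).
        apply is_lim_seq_mult'; [now apply rising_bin_ratio_lim_index|now apply rising_bin_ratio_lim_arg].
    - right. split; [lra|]. now rewrite Rinv_1. }
  apply ex_series_ext with (2 := h). intros n. f_equal. simpl. ring.
Qed.

Lemma Series_sum_f_R0 (u : nat -> nat -> R) K :
  (forall j, (j <= K)%nat -> ex_series (u j)) ->
  sum_f_R0 (fun j => Series (u j)) K = Series (fun n => sum_f_R0 (fun j => u j n) K)
  /\ ex_series (fun n => sum_f_R0 (fun j => u j n) K).
Proof.
  intros h. induction K as [|K IH]; simpl.
  - split; [reflexivity|]. apply h; lia.
  - destruct IH as [IH1 IH2]; [intros; apply h; lia|].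
    assert (hS := h (S K) ltac:(lia)).
    split.
    + rewrite IH1, <- Series_plus by assumption. reflexivity.
    + apply (ex_series_plus (V := R_NormedModule)); assumption.
Qed.

(* [negbin m N] is the coefficient of [s^N] in [(1-s)^(-c) ((1-s)^a + mu)^(-m)],
   expanded in powers of [mu]. *)
Definition negbin (a c mu : R) (m N : nat) : R :=
  Series (fun n => rising_bin (INR m) n * (- mu) ^ n * rising_bin (c + a * INR m + a * INR n) N).

Lemma negbin_0 a c mu N : negbin a c mu 0 N = rising_bin c N.
Proof.
  unfold negbin. apply is_series_unique.
  assert (h : is_series (fun n => match n with O => rising_bin c N | S _ => 0 end) (rising_bin c N)).
  { change (is_lim_seq (sum_n (fun n => match n with O => rising_bin c N | S _ => 0 end)) (rising_bin c N)).
    apply (is_lim_seq_ext (fun _ => rising_bin c N)); [|apply is_lim_seq_const].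
    intros n. rewrite sum_n_Reals. induction n as [|n IH]; [reflexivity|].
    simpl sum_f_R0. rewrite Rplus_0_r. exact IH. }
  apply is_series_ext with (2 := h).
  enough (he : forall n, match n with O => rising_bin c N | S _ => 0 end
     = rising_bin (INR 0) n * (- mu) ^ n * rising_bin (c + a * INR 0 + a * INR n) N) by exact he.
  intros [|n].
  - simpl rising_bin. simpl INR. rewrite !Rmult_0_r, !Rplus_0_r. simpl; ring.
  - assert (h2 := not_0_INR (S n) ltac:(lia)).
    assert (rising_bin (INR 0) (S n) = 0) as ->; [|ring].
    apply Rmult_eq_reg_l with (2 := h2). rewrite rising_bin_shift. simpl (INR 0). ring.
Qed.

(** Multiplying the generating function for [S m] by [(1 - s)^a + mu] gives the one for [m].
    Vandermonde's identity performs the product with [(1 - s)^a], and [mu < 1] makes the expansion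
    in powers of [mu] converge. *)
Lemma negbin_rec a c mu m N : 0 < a -> 0 <= c -> 0 <= mu < 1 ->
  sum_f_R0 (fun j => rising_bin (- a) j * negbin a c mu (S m) (N - j)) N + mu * negbin a c mu (S m) N
  = negbin a c mu m N.
Proof.
  intros ha hc hmu.
  assert (hm : 0 < INR (S m)) by (apply lt_0_INR; lia).
  assert (ex : forall K, ex_series (fun n => rising_bin (INR (S m)) n * (- mu) ^ n *
       rising_bin (c + a * INR (S m) + a * INR n) K)).
  { intros K. apply ex_series_Rabs. apply rising_bin_ex_series; try assumption; [nra|].
    rewrite Rabs_Ropp, Rabs_right; lra. }
  unfold negbin.
  rewrite (sum_eq _ (fun j => Series (fun n => rising_bin (- a) j * (rising_bin (INR (S m)) n * (- mu) ^ n *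
       rising_bin (c + a * INR (S m) + a * INR n) (N - j))))).
  2: { intros j hj. now rewrite Series_scal_l. }
  destruct (Series_sum_f_R0 (fun j n => rising_bin (- a) j * (rising_bin (INR (S m)) n * (- mu) ^ n *
       rising_bin (c + a * INR (S m) + a * INR n) (N - j))) N) as [e1 e2].
  { intros j hj. apply (ex_series_scal_l (V := R_NormedModule) (rising_bin (- a) j)). apply ex. }
  rewrite e1.
  (* The series multiplied by [mu], reindexed by one so that its terms align with equal powers of
     [mu] in the other series; [rising_bin_pascal] then merges the coefficients. *)
  set (W := fun n => match n with O => 0 | S k =>
     mu * (rising_bin (INR (S m)) k * (- mu) ^ k * rising_bin (c + a * INR (S m) + a * INR k) N) end).
  assert (eW : ex_series W).
  { apply ex_series_incr_1. simpl. apply (ex_series_scal_l (V := R_NormedModule) mu). apply ex. }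
  rewrite <- Series_scal_l.
  assert (Series (fun n => mu * (rising_bin (INR (S m)) n * (- mu) ^ n *
       rising_bin (c + a * INR (S m) + a * INR n) N)) = Series W) as ->.
  { rewrite (Series_incr_1 W eW). simpl. ring. }
  rewrite <- Series_plus by assumption.
  apply Series_ext. intros n.
  rewrite (sum_eq _ (fun j => rising_bin (- a) j * rising_bin (c + a * INR (S m) + a * INR n) (N - j) *
     (rising_bin (INR (S m)) n * (- mu) ^ n))) by (intros; ring).
  rewrite <- scal_sum, rising_bin_vandermonde.
  replace (- a + (c + a * INR (S m) + a * INR n)) with (c + a * INR m + a * INR n)
    by (rewrite S_INR; ring).
  destruct n as [|n]; unfold W; [simpl; ring|].
  rewrite (S_INR m), <- (rising_bin_pascal (INR m)).
  replace (c + a * (INR m + 1) + a * INR n) with (c + a * INR m + a * INR (S n))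
    by (rewrite S_INR; ring).
  simpl pow. ring.
Qed.

(* [- rising_bin (- a) j >= 0] for [j >= 1], because [0 < a <= 1], so solving the recursion for the term [j = 0]
   involves only nonnegative quantities. *)
Lemma negbin_nonneg a c mu m N : 0 < a <= 1 -> 0 <= c -> 0 <= mu < 1 -> 0 <= negbin a c mu m N.
Proof.
  intros ha hc hmu. revert N. induction m as [|m IHm]; intros N.
  - rewrite negbin_0. now apply rising_bin_nonneg.
  - induction N as [N IHN] using (well_founded_induction Nat.lt_wf_0).
    assert (h := negbin_rec a c mu m N ltac:(lra) hc hmu).
    assert (hm := IHm N).
    (* The terms with [j >= 1] are nonpositive, so the sum is at most its term [j = 0]. The
       recursion then gives [negbin m N <= (1 + mu) * negbin (S m) N], parameters [a c mu]
       omitted. *)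
    assert (hs : sum_f_R0 (fun j => rising_bin (- a) j * negbin a c mu (S m) (N - j)) N
      <= negbin a c mu (S m) N).
    { destruct N as [|N]; [simpl; lra|].
      rewrite (decomp_sum (fun j => rising_bin (- a) j * negbin a c mu (S m) (S N - j))) by lia.
      simpl Nat.pred.
      assert (sum_f_R0 (fun i => rising_bin (- a) (S i) * negbin a c mu (S m) (S N - S i)) N <= 0).
      { rewrite <- (sum_eq_R0 (fun _ => 0) N) by reflexivity.
        apply sum_Rle. intros j hj.
        assert (h1 := rising_bin_opp_nonpos a j ha).
        assert (h2 := IHN (S N - S j)%nat ltac:(lia)). nra. }
      simpl rising_bin at 1. rewrite Nat.sub_0_r. lra. }
    nra.
Qed.

(** * Positivity of the derivatives of Mittag-Leffler functions on the negative half-line *)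

(** Telescopes the functional equation. The value [Gamma 1] is carried along as a positive
    constant. *)
Lemma rising_bin_Gamma s N : 0 < s ->
  rising_bin s N * Gamma s * Gamma (INR N + 1) = Gamma (s + INR N) * Gamma 1.
Proof.
  intros hs. induction N as [|N IH].
  - simpl. rewrite Rplus_0_l, Rplus_0_r. ring.
  - assert (hN := pos_INR N).
    rewrite S_INR, (Gamma_succ (INR N + 1)) by lra.
    replace (s + (INR N + 1)) with (s + INR N + 1) by ring. rewrite (Gamma_succ (s + INR N)) by lra.
    rewrite (Rmult_assoc (s + INR N)), <- IH, <- S_INR.
    replace (rising_bin s (S N) * Gamma s * (INR (S N) * Gamma (INR (S N))))
      with ((INR (S N) * rising_bin s (S N)) * Gamma s * Gamma (INR (S N))) by ring.
    rewrite rising_bin_S. ring.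
Qed.

Lemma filterlim_Rpower_1 {T} (F : (T -> Prop) -> Prop) {FF : Filter F} (f : T -> R) s :
  filterlim f F (locally 1) -> filterlim (fun k => Rpower (f k) s) F (locally 1).
Proof.
  intros h. apply (filterlim_comp _ _ _ f (fun t => Rpower t s) _ _ _ h).
  replace (locally 1) with (locally (Rpower 1 s)) at 2.
  - apply (ex_derive_continuous (fun t => Rpower t s)). eexists. apply is_derive_Rpower. lra.
  - unfold Rpower. now rewrite ln_1, Rmult_0_r, exp_0.
Qed.

Lemma Rpower_opp_lim a : 0 < a ->
  filterlim (fun x => Rpower x (- a)) (Rbar_locally p_infty) (locally 0).
Proof.
  intros ha. apply filterlim_locally. intros eps. assert (he := cond_pos eps).
  exists (Rpower eps (- / a)). intros x hx.
  assert (hp := Rpower_pos eps (- / a)). assert (hq := Rpower_pos x (- a)).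
  apply Rabs_lt_between. unfold minus, plus, opp; simpl.
  assert (Rpower x (- a) < eps); [|lra].
  assert (h : Rpower (Rpower eps (- / a)) a < Rpower x a) by (apply Rlt_Rpower_l; lra).
  rewrite Rpower_mult in h. replace (- / a * a) with (- (1)) in h by (field; lra).
  rewrite Rpower_Ropp, Rpower_1 in h by lra.
  rewrite Rpower_Ropp. rewrite <- (Rinv_inv eps).
  apply Rinv_lt_contravar; [|assumption].
  apply Rmult_lt_0_compat; [now apply Rinv_0_lt_compat|apply Rpower_pos].
Qed.

(** By [Gamma_ratio_lower], the quotient lies between 0 and [(s - 1)^(- a)]. *)
Lemma Gamma_ratio_lim_0 a : 0 < a ->
  filterlim (fun s => Gamma s / Gamma (s + a)) (Rbar_locally p_infty) (locally 0).
Proof.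
  intros ha.
  apply (filterlim_le_le (F := Rbar_locally p_infty) (fun _ => 0) _ (fun s => Rpower (s - 1) (- a)) 0).
  - exists 1. intros s hs.
    assert (h1 := Gamma_pos s ltac:(lra)). assert (h2 := Gamma_pos (s + a) ltac:(lra)).
    split; [left; now apply Rdiv_lt_0_compat|].
    assert (h := Gamma_ratio_lower s a hs ha).
    assert (hp := Rpower_pos (s - 1) a).
    rewrite Rpower_Ropp. apply Rmult_le_reg_r with (Gamma (s + a)); [assumption|].
    unfold Rdiv. rewrite Rmult_assoc, Rinv_l by lra.
    apply Rmult_le_reg_l with (Rpower (s - 1) a); [assumption|].
    rewrite <- (Rmult_assoc _ (/ _)), Rinv_r by lra. lra.
  - apply filterlim_const.
  - apply (filterlim_comp _ _ _ (fun s => s - 1) (fun x => Rpower x (- a)) _ (Rbar_locally p_infty));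
      [|now apply Rpower_opp_lim].
    intros Q [M hM]. exists (M + 1). intros x hx. apply hM. lra.
Qed.

Lemma is_lim_seq_affine_p t a : 0 < a -> is_lim_seq (fun n => t + a * INR n) p_infty.
Proof.
  intros ha. intros Q [M hM].
  destruct (archimed ((M - t) / a)) as [h _].
  exists (Z.to_nat (up ((M - t) / a))). intros n hn. apply hM.
  assert (IZR (up ((M - t) / a)) <= INR n).
  { rewrite INR_IZR_INZ. apply IZR_le. lia. }
  assert ((M - t) / a < INR n) by lra.
  apply (Rmult_lt_compat_l a) in H0; [|assumption].
  replace (a * ((M - t) / a)) with (M - t) in H0 by (field; lra). lra.
Qed.

Lemma CV_radius_infinite_Gamma a t m : 0 < a -> 0 < t -> 0 < m ->
  CV_radius (fun n => rising_bin m n / Gamma (t + a * INR n)) = p_infty.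
Proof.
  intros ha ht hm.
  assert (hG : forall n, 0 < Gamma (t + a * INR n)).
  { intros n. apply Gamma_pos. assert (hn := pos_INR n). nra. }
  apply CV_radius_infinite_DAlembert.
  - intros n. assert (h := Rdiv_lt_0_compat _ _ (rising_bin_pos m n hm) (hG n)). lra.
  - apply is_lim_seq_ext with (fun n => (rising_bin m (S n) / rising_bin m n) *
       (Gamma (t + a * INR n) / Gamma (t + a * INR n + a))).
    + intros n. assert (h1 := rising_bin_pos m n hm). assert (h2 := rising_bin_pos m (S n) hm).
      assert (h3 := hG n). assert (h4 := hG (S n)).
      replace (t + a * INR n + a) with (t + a * INR (S n)) by (rewrite S_INR; ring).
      rewrite Rabs_right.
      * field. lra.
      * apply Rle_ge. left. apply Rdiv_lt_0_compat; now apply Rdiv_lt_0_compat.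
    + replace (Finite 0) with (Finite (1 * 0)) by (f_equal; ring).
      apply is_lim_seq_mult'; [now apply rising_bin_ratio_lim_index|].
      apply (filterlim_comp _ _ _ (fun n => t + a * INR n) (fun s => Gamma s / Gamma (s + a)) _
        (Rbar_locally p_infty)); [now apply is_lim_seq_affine_p|now apply Gamma_ratio_lim_0].
Qed.

(** * Gauss's product formula *)

Lemma Rpower_bernoulli x s : 0 <= x -> 1 <= s -> 1 + s * x <= Rpower (1 + x) s.
Proof.
  intros hx hs.
  assert (0 < / s) by (apply Rinv_0_lt_compat; lra).
  assert (/ s <= 1) by (rewrite <- Rinv_1; apply Rinv_le_contravar; lra).
  (* Arithmetic-geometric mean inequality for [(1 + x)^s] and [1], with weights [1/s] and
     [1 - 1/s]. *)
  assert (h := weighted_AMGM (Rpower (1 + x) s) 1 (/ s) (Rpower_pos _ _) Rlt_0_1 ltac:(lra)).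
  rewrite Rpower_mult, Rinv_r, Rpower_1 in h by lra.
  replace (Rpower 1 (1 - / s)) with 1 in h
    by (unfold Rpower; now rewrite ln_1, Rmult_0_r, exp_0).
  apply (Rmult_le_compat_l s) in h; [|lra].
  replace (s * (/ s * Rpower (1 + x) s + (1 - / s) * 1)) with (Rpower (1 + x) s + s - 1) in h
    by (field; lra).
  lra.
Qed.

Lemma Rpower_div x y c : 0 < x -> 0 < y -> Rpower (x / y) c = Rpower x c / Rpower y c.
Proof.
  intros hx hy. unfold Rpower. rewrite ln_div by assumption.
  rewrite Rmult_minus_distr_l. unfold Rminus, Rdiv. now rewrite exp_plus, exp_Ropp.
Qed.

(** The coefficient grows like [N^(s-1)]; the power removes this growth, so that Gauss's product
    formula becomes the convergence of [gauss s]. *)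
Definition gauss (s : R) (N : nat) : R := rising_bin s N * Rpower (INR N) (1 - s).

Lemma gauss_Gamma s N : 0 < s -> (0 < N)%nat ->
  gauss s N = Gamma 1 / Gamma s * (Gamma (INR N + s) / Gamma (INR N) / Rpower (INR N) s).
Proof.
  intros hs hN. assert (h := lt_0_INR N hN). unfold gauss.
  assert (g1 := Gamma_pos s hs). assert (g2 := Gamma_pos (INR N) h).
  assert (e := rising_bin_Gamma s N hs). rewrite Gamma_succ in e by assumption.
  assert (hp := Rpower_pos (INR N) s).
  unfold Rminus. rewrite Rpower_plus, Rpower_1, Rpower_Ropp by assumption.
  rewrite (Rplus_comm (INR N) s).
  apply Rmult_eq_reg_r with (Gamma s * Gamma (INR N) * Rpower (INR N) s); [|
    apply Rgt_not_eq; repeat apply Rmult_lt_0_compat; assumption].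
  field_simplify; [|lra|lra]. lra.
Qed.

Lemma gauss_upper s N : 0 < s -> (0 < N)%nat ->
  gauss s N <= Gamma 1 / Gamma s * Rpower (1 + s * / INR N) s.
Proof.
  intros hs hN. assert (h := lt_0_INR N hN). rewrite gauss_Gamma by assumption.
  assert (g1 := Gamma_pos s hs). assert (g2 := Gamma_pos (INR N) h).
  assert (hp := Rpower_pos (INR N) s).
  apply Rmult_le_compat_l; [left; apply Rdiv_lt_0_compat; [apply Gamma_pos; lra|assumption]|].
  replace (1 + s * / INR N) with ((INR N + s) / INR N) by (field; lra).
  rewrite Rpower_div by lra. unfold Rdiv.
  apply Rmult_le_compat_r; [left; now apply Rinv_0_lt_compat|].
  apply Rmult_le_reg_r with (Gamma (INR N)); [assumption|].
  rewrite Rmult_assoc, Rinv_l, Rmult_1_r by lra. now apply Gamma_ratio_upper.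
Qed.

Lemma gauss_lower s N : 0 < s -> (1 < N)%nat ->
  Gamma 1 / Gamma s * Rpower (1 + - (1) * / INR N) s <= gauss s N.
Proof.
  intros hs hN. assert (h := lt_1_INR N hN). rewrite gauss_Gamma by (assumption || lia).
  assert (g1 := Gamma_pos s hs). assert (g2 := Gamma_pos (INR N) ltac:(lra)).
  assert (hp := Rpower_pos (INR N) s).
  apply Rmult_le_compat_l; [left; apply Rdiv_lt_0_compat; [apply Gamma_pos; lra|assumption]|].
  replace (1 + - (1) * / INR N) with ((INR N - 1) / INR N) by (field; lra).
  rewrite Rpower_div by lra. unfold Rdiv.
  apply Rmult_le_compat_r; [left; now apply Rinv_0_lt_compat|].
  apply Rmult_le_reg_r with (Gamma (INR N)); [assumption|].
  rewrite Rmult_assoc, Rinv_l, Rmult_1_r by lra. now apply Gamma_ratio_lower.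
Qed.

Lemma is_lim_seq_1_add_inv k : is_lim_seq (fun n => 1 + k * / INR n) 1.
Proof.
  replace (Finite 1) with (Finite (1 + k * 0)) by (f_equal; ring).
  apply is_lim_seq_plus'; [apply is_lim_seq_const|].
  apply is_lim_seq_mult'; [apply is_lim_seq_const|].
  apply (is_lim_seq_inv _ p_infty); [apply is_lim_seq_INR|discriminate].
Qed.

(** Both bounds have the form [(1 + k / N)^s], with [k = -1] and [k = s], up to the constant
    [Gamma 1 / Gamma s]. *)
Lemma gauss_lim s : 0 < s -> is_lim_seq (gauss s) (Gamma 1 / Gamma s).
Proof.
  intros hs.
  assert (h : forall k, is_lim_seq (fun N => Gamma 1 / Gamma s * Rpower (1 + k * / INR N) s)
     (Gamma 1 / Gamma s)).
  { intros k. replace (Finite (Gamma 1 / Gamma s)) with (Finite (Gamma 1 / Gamma s * 1))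
      by (f_equal; ring).
    apply is_lim_seq_mult'; [apply is_lim_seq_const|].
    apply (filterlim_Rpower_1 eventually). apply is_lim_seq_1_add_inv. }
  apply is_lim_seq_le_le_loc with (2 := h (- (1))) (3 := h s).
  exists 2%nat. intros N hN. split; [apply gauss_lower|apply gauss_upper]; assumption || lia.
Qed.

Lemma gauss_nonneg s N : 0 < s -> 0 <= gauss s N.
Proof.
  intros hs. apply Rmult_le_pos; left; [now apply rising_bin_pos|apply Rpower_pos].
Qed.

(** The quotient of consecutive terms is [(1 + s / N) / (1 + 1 / N)^s], at most 1 by Bernoulli's
    inequality. *)
Lemma gauss_decr s N : 1 <= s -> (0 < N)%nat -> gauss s (S N) <= gauss s N.
Proof.
  intros hs hN. assert (h := lt_0_INR N hN). unfold gauss.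
  assert (hr := rising_bin_pos s N ltac:(lra)).
  simpl rising_bin. unfold Rdiv. rewrite !Rmult_assoc.
  apply Rmult_le_compat_l; [lra|].
  unfold Rminus. rewrite !Rpower_plus, !Rpower_Ropp, !Rpower_1 by (try rewrite S_INR; lra).
  assert (hb := Rpower_bernoulli (/ INR N) s ltac:(left; now apply Rinv_0_lt_compat) hs).
  replace (1 + / INR N) with (INR (S N) / INR N) in hb by (rewrite S_INR; field; lra).
  rewrite Rpower_div in hb by (try rewrite S_INR; lra).
  change (match N with O => 1 | S _ => INR N + 1 end) with (INR (S N)).
  assert (h1 := Rpower_pos (INR (S N)) s). assert (h2 := Rpower_pos (INR N) s).
  assert (h3 : 0 < INR (S N)) by (rewrite S_INR; lra).
  apply Rmult_le_reg_r with (Rpower (INR (S N)) s); [assumption|].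
  apply (Rmult_le_compat_l (INR N)) in hb; [|lra].
  replace (INR N * (1 + s * / INR N)) with (s + INR N) in hb by (field; lra).
  field_simplify; [|lra|lra]. eapply Rle_trans; [exact hb|]. right; field; lra.
Qed.

(** A bound independent of [N], used to dominate the series in [ML_deriv_nonneg]. For [s >= 1] the
    sequence decreases from [N0] on; for [s < 1] the factor [(1 + s / N)^s] in [gauss_upper] is at
    most 2. The sum covers both cases. *)
Lemma gauss_bound s N0 N : 0 < s -> (0 < N0 <= N)%nat ->
  gauss s N <= gauss s N0 + 2 * (Gamma 1 / Gamma s).
Proof.
  intros hs [h0 hN].
  assert (g1 := Gamma_pos s hs). assert (g2 := Gamma_pos 1 Rlt_0_1).
  assert (g3 := Rdiv_lt_0_compat _ _ g2 g1).
  destruct (Rle_lt_dec 1 s) as [h1|h1].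
  - assert (gauss s N <= gauss s N0); [|lra].
    induction hN as [|N hN IH]; [lra|].
    apply Rle_trans with (2 := IH). apply gauss_decr; [assumption|lia].
  - assert (hu := gauss_upper s N hs ltac:(lia)). assert (hp := gauss_nonneg s N0 hs).
    assert (hN1 : 1 <= INR N) by (change 1 with (INR 1); apply le_INR; lia).
    assert (hi : 0 < / INR N <= 1).
    { split; [apply Rinv_0_lt_compat; lra|rewrite <- Rinv_1; apply Rinv_le_contravar; lra]. }
    assert (hb : Rpower (1 + s * / INR N) s <= Rpower (1 + s * / INR N) 1)
      by (apply Rle_Rpower; nra).
    rewrite Rpower_1 in hb by nra.
    assert (h2 : Rpower (1 + s * / INR N) s <= 2) by nra.
    apply (Rmult_le_compat_l (Gamma 1 / Gamma s)) in h2; lra.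
Qed.

(** * Passage from the generating functions to Mittag-Leffler derivatives *)

Lemma ex_series_entire (c : nat -> R) x : CV_radius c = p_infty ->
  ex_series (fun n => Rabs (c n * x ^ n)).
Proof. intros h. apply CV_disk_inside. rewrite h. exact I. Qed.

(* [E_{a,c+a}^(m-1)] is nonnegative on the negative half-line. *)
Lemma ML_deriv_nonneg a c m y : 0 < a <= 1 -> 0 <= c -> (0 < m)%nat -> 0 <= y ->
  0 <= PSeries (fun n => rising_bin (INR m) n / Gamma (c + a * INR m + a * INR n)) (- y).
Proof.
  intros ha hc hm hy.
  assert (hm' := lt_0_INR m hm).
  set (t := c + a * INR m). assert (ht : 0 < t) by (unfold t; nra).
  assert (hs : forall n, 0 < t + a * INR n) by (intros n; assert (hn := pos_INR n); nra).
  assert (g1 := Gamma_pos 1 Rlt_0_1).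
  set (l := fun n => rising_bin (INR m) n * (- y) ^ n * (Gamma 1 / Gamma (t + a * INR n))).
  (* [u N] is the series of [negbin] at [mu = y / N^a], multiplied by [N^(1-t)]; [l] is its termwise
     limit. *)
  set (u := fun N n => rising_bin (INR m) n * (- y) ^ n * gauss (t + a * INR n) N).
  assert (hpow : forall N n, (0 < N)%nat ->
     Rpower (INR N) (1 - (t + a * INR n)) = Rpower (INR N) (1 - t) * (Rpower (INR N) (- a)) ^ n).
  { intros N n hN. assert (h := lt_0_INR N hN).
    rewrite <- Rpower_pow, Rpower_mult, <- Rpower_plus by apply Rpower_pos.
    f_equal. ring. }
  assert (hmu : is_lim_seq (fun N => y * Rpower (INR N) (- a)) 0).
  { replace (Finite 0) with (Finite (y * 0)) by (f_equal; ring).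
    apply is_lim_seq_mult'; [apply is_lim_seq_const|].
    apply (filterlim_comp _ _ _ INR (fun x => Rpower x (- a)) _ (Rbar_locally p_infty));
      [apply is_lim_seq_INR|apply Rpower_opp_lim; lra]. }
  (* From [N0] on the parameter [mu] is below 1, as [negbin_nonneg] and the convergence of the
     dominating series require. *)
  assert (hev : exists N0, (0 < N0)%nat /\ forall N, (N0 <= N)%nat -> y * Rpower (INR N) (- a) < 1).
  { destruct (proj1 (filterlim_locally _ _) hmu (mkposreal 1 Rlt_0_1)) as [N0 h0].
    exists (S N0). split; [lia|]. intros N hN. specialize (h0 N ltac:(lia)).
    apply Rabs_lt_between in h0. unfold minus, plus, opp in h0; simpl in h0. lra. }
  destruct hev as [N0 [hN0 hev]].
  assert (hmu0 : forall N, 0 <= y * Rpower (INR N) (- a)).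
  { intros N. apply Rmult_le_pos; [assumption|left; apply Rpower_pos]. }
  assert (eu : forall N, (0 < N)%nat -> Series (u N) =
     Rpower (INR N) (1 - t) * negbin a c (y * Rpower (INR N) (- a)) m N).
  { intros N hN. unfold negbin. rewrite <- Series_scal_l. apply Series_ext. intros n.
    unfold u, gauss. rewrite hpow by assumption. fold t.
    replace (- (y * Rpower (INR N) (- a))) with (- y * Rpower (INR N) (- a)) by ring.
    rewrite Rpow_mult_distr. ring. }
  assert (hlim : is_lim_seq (fun N => Series (u N)) (Series l)).
  { apply (Series_dominated_lim eventually u l (fun n =>
      Rpower (INR N0) (1 - t) *
        Rabs (rising_bin (INR m) n * (y * Rpower (INR N0) (- a)) ^ n * rising_bin (t + a * INR n) N0)
      + 2 * Gamma 1 * Rabs (rising_bin (INR m) n / Gamma (t + a * INR n) * y ^ n))).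
    - apply (ex_series_plus (V := R_NormedModule)).
      + apply (ex_series_scal_l (V := R_NormedModule)). apply rising_bin_ex_series; try lra.
        rewrite Rabs_right by (apply Rle_ge, hmu0). now apply hev.
      + apply (ex_series_scal_l (V := R_NormedModule)).
        apply (ex_series_entire (fun n => rising_bin (INR m) n / Gamma (t + a * INR n))).
        apply CV_radius_infinite_Gamma; lra.
    - exists N0. intros N hN n. unfold u.
      assert (h1 := rising_bin_pos (INR m) n hm').
      assert (h2 := gauss_bound (t + a * INR n) N0 N (hs n) ltac:(lia)).
      assert (h3 := gauss_nonneg (t + a * INR n) N (hs n)).
      assert (h4 := rising_bin_pos (t + a * INR n) N0 (hs n)).
      assert (h5 := Gamma_pos _ (hs n)).
      assert (h6 : 0 <= y ^ n) by now apply pow_le.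
      rewrite !Rabs_mult, <- !RPow_abs, Rabs_Ropp, (Rabs_right y) by lra.
      rewrite (Rabs_right (rising_bin _ _)), (Rabs_right (gauss _ _)), (Rabs_right (rising_bin _ N0)) by lra.
      rewrite (Rabs_right (y * _)) by (apply Rle_ge, hmu0).
      rewrite (Rabs_right (_ / _)) by (apply Rle_ge; left; now apply Rdiv_lt_0_compat).
      apply Rle_trans with (rising_bin (INR m) n * y ^ n *
        (gauss (t + a * INR n) N0 + 2 * (Gamma 1 / Gamma (t + a * INR n)))).
      + apply Rmult_le_compat_l; [|assumption]. apply Rmult_le_pos; lra.
      + right. unfold gauss. rewrite hpow by assumption. rewrite Rpow_mult_distr. field. lra.
    - intros n. unfold l.
      assert (h1 := rising_bin_pos (INR m) n hm').
      assert (h5 := Gamma_pos _ (hs n)).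
      assert (h6 : 0 <= y ^ n) by now apply pow_le.
      assert (h7 : 0 <= Rpower (INR N0) (1 - t) *
        Rabs (rising_bin (INR m) n * (y * Rpower (INR N0) (- a)) ^ n * rising_bin (t + a * INR n) N0)).
      { apply Rmult_le_pos; [left; apply Rpower_pos|apply Rabs_pos]. }
      set (A := Rpower (INR N0) (1 - t) * _) in *.
      rewrite !Rabs_mult, <- !RPow_abs, Rabs_Ropp, (Rabs_right y) by lra.
      assert (h8 := Rdiv_lt_0_compat _ _ g1 h5).
      assert (h9 := Rdiv_lt_0_compat _ _ h1 h5).
      rewrite !(Rabs_right (_ / _)) by lra. rewrite (Rabs_right (rising_bin _ _)) by lra.
      replace (2 * Gamma 1 * (rising_bin (INR m) n / Gamma (t + a * INR n) * y ^ n)) with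
        (2 * (rising_bin (INR m) n * y ^ n * (Gamma 1 / Gamma (t + a * INR n)))) by (field; lra).
      assert (0 <= rising_bin (INR m) n * y ^ n * (Gamma 1 / Gamma (t + a * INR n)))
        by (apply Rmult_le_pos; [apply Rmult_le_pos|]; lra).
      lra.
    - intros n. unfold u, l.
      apply (is_lim_seq_mult' (fun _ => rising_bin (INR m) n * (- y) ^ n)); [apply is_lim_seq_const|].
      now apply gauss_lim. }
  assert (hl : 0 <= Series l).
  { apply (is_lim_seq_le_loc (fun _ => 0) (fun N => Series (u N)) 0 (Series l));
      [|apply is_lim_seq_const|assumption].
    exists N0. intros N hN. rewrite eu by lia.
    apply Rmult_le_pos; [left; apply Rpower_pos|].
    apply negbin_nonneg; [assumption..|]. split; [apply hmu0|now apply hev]. }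
  apply Rmult_le_reg_l with (1 := g1). rewrite Rmult_0_r.
  unfold PSeries. rewrite <- Series_scal_l.
  replace (Series _) with (Series l); [assumption|].
  apply Series_ext. intros n. unfold l, Rdiv. ring.
Qed.

(** * Convex entire series *)

Definition entire (c : nat -> R) : Prop := forall x, ex_series (fun n => Rabs (c n * x ^ n)).

Lemma entire_CV_radius c : entire c -> CV_radius c = p_infty.
Proof.
  intros h. destruct (Lub_Rbar_correct (CV_disk c)) as [hub _].
  change (Lub_Rbar (CV_disk c)) with (CV_radius c) in hub.
  destruct (CV_radius c) as [r| |]; [|reflexivity|].
  - assert (hr := hub (r + 1) (h (r + 1))). simpl in hr. lra.
  - destruct (hub 0 (h 0)).
Qed.

Lemma entire_lt c x : entire c -> Rbar_lt (Rabs x) (CV_radius c).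
Proof. intros h. rewrite entire_CV_radius by assumption. exact I. Qed.

Lemma CV_radius_entire c : CV_radius c = p_infty -> entire c.
Proof. intros h x. now apply ex_series_entire. Qed.

Lemma entire_ex_series c x : entire c -> ex_series (fun n => c n * x ^ n).
Proof. intros h. apply ex_series_Rabs, h. Qed.

Lemma entire_ex_pseries c x : entire c -> ex_pseries c x.
Proof. intros h. now apply ex_pseries_R, entire_ex_series. Qed.

Lemma entire_derive c : entire c -> entire (PS_derive c).
Proof.
  intros h. apply CV_radius_entire. rewrite CV_radius_derive. now apply entire_CV_radius.
Qed.

Lemma entire_le c d K : entire c -> (forall n, Rabs (d n) <= K * Rabs (c n)) -> entire d.
Proof.
  intros h hd x.
  apply (ex_series_le (V := R_CompleteNormedModule) _ (fun n => K * Rabs (c n * x ^ n))).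
  - intros n. unfold norm; simpl; unfold abs; simpl. rewrite Rabs_Rabsolu, !Rabs_mult.
    rewrite <- Rmult_assoc. apply Rmult_le_compat_r; [apply Rabs_pos|apply hd].
  - apply (ex_series_scal_l (V := R_NormedModule)), h.
Qed.

Lemma entire_dilate c r : entire c -> entire (fun n => c n * r ^ n).
Proof.
  intros h x. apply ex_series_ext with (2 := h (r * x)). intros n.
  rewrite Rpow_mult_distr. f_equal. ring.
Qed.

Lemma PSeries_nonneg c x : (forall n, 0 <= c n) -> entire c -> 0 <= x -> 0 <= PSeries c x.
Proof.
  intros hc he hx. unfold PSeries.
  replace 0 with (Series (fun _ => 0 * 0)) by (rewrite Series_scal_l; ring).
  apply Series_le; [|now apply entire_ex_series].
  intros n. rewrite Rmult_0_l. split; [lra|]. apply Rmult_le_pos; [apply hc|now apply pow_le].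
Qed.

Lemma PSeries_dilate c r x : PSeries (fun n => c n * r ^ n) x = PSeries c (r * x).
Proof. apply Series_ext. intros n. rewrite Rpow_mult_distr. ring. Qed.

Lemma PSeries_scal_ext c d k x : (forall n, d n = k * c n) -> PSeries d x = k * PSeries c x.
Proof.
  intros h. rewrite <- PSeries_scal. apply PSeries_ext. exact h.
Qed.

(** The multiplier [q + n] on coefficients is the operator [q + y d/dy]. *)
Lemma PSeries_euler D q y : entire D ->
  PSeries (fun n => (q + INR n) * D n) y = q * PSeries D y + y * PSeries (PS_derive D) y.
Proof.
  intros h. rewrite <- PSeries_incr_1, <- PSeries_scal, <- PSeries_plus.
  - apply PSeries_ext. intros [|n]; unfold PS_plus, PS_scal, PS_incr_1, PS_derive;
      unfold plus, scal, zero; simpl; unfold mult; simpl; ring.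
  - apply ex_pseries_scal; [apply Rmult_comm|now apply entire_ex_pseries].
  - apply ex_pseries_incr_1. now apply entire_ex_pseries, entire_derive.
Qed.

Lemma is_derive_PSeries_comp D x t : entire D ->
  is_derive (fun t => PSeries D (t * x)) t (x * PSeries (PS_derive D) (t * x)).
Proof.
  intros h. apply (is_derive_comp (PSeries D) (fun t => t * x)).
  - apply is_derive_PSeries. now apply entire_lt.
  - auto_derive; [exact I|ring].
Qed.

(* The derivative of [t^q D(t x)] in [t] is [t^(q-1)] times the series of the hypothesis at [t x]. *)
Lemma PSeries_pos_of_euler D q : 0 < q -> entire D -> 0 < D O ->
  (forall x, 0 <= PSeries (fun n => (q + INR n) * D n) x) ->
  forall x, 0 < PSeries D x.
Proof.
  intros hq hD hD0 h x.
  assert (hder : forall t, 0 < t -> is_derive (fun t => Rpower t q * PSeries D (t * x)) t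
     (Rpower t (q - 1) * PSeries (fun n => (q + INR n) * D n) (t * x))).
  { intros t ht. rewrite PSeries_euler by assumption.
    replace (Rpower t (q - 1) * (q * PSeries D (t * x) + t * x * PSeries (PS_derive D) (t * x)))
      with (q * Rpower t (q - 1) * PSeries D (t * x)
        + Rpower t q * (x * PSeries (PS_derive D) (t * x))).
    - apply (is_derive_mult (fun t => Rpower t q) (fun t => PSeries D (t * x))).
      + now apply is_derive_Rpower.
      + now apply is_derive_PSeries_comp.
      + intros; apply Rmult_comm.
    - replace q with (q - 1 + 1) at 3 by ring. rewrite Rpower_plus, Rpower_1 by assumption. ring. }
  assert (hc : continuous (fun t => PSeries D (t * x)) 0).
  { apply (ex_derive_continuous (fun t => PSeries D (t * x))). eexists.
    now apply is_derive_PSeries_comp. }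
  assert (h0 : PSeries D (0 * x) = D O) by (rewrite Rmult_0_l; apply PSeries_0).
  destruct (proj1 (filterlim_locally _ _) hc (mkposreal _ hD0)) as [eps heps].
  assert (he := cond_pos eps).
  (* A point of [(0, 1)] close enough to 0 that [D(t x)] is positive by continuity, since
     [D(0) > 0]. *)
  set (t := Rmin (1 / 2) (eps / 2)).
  assert (ht : 0 < t <= 1 / 2 /\ t <= eps / 2).
  { unfold t. split; [split; [apply Rmin_glb_lt; lra|apply Rmin_l]|apply Rmin_r]. }
  specialize (heps t).
  assert (hp : 0 < PSeries D (t * x)).
  { assert (hb : ball 0 eps t).
    { apply Rabs_lt_between. unfold minus, plus, opp; simpl. lra. }
    apply heps, Rabs_lt_between in hb. simpl in hb.
    unfold minus, plus, opp in hb; simpl in hb. rewrite h0 in hb. lra. }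
  (* The function [t^q D(t x)] does not decrease between [t] and 1, so its value [D(x)] at 1
     inherits strict positivity. *)
  destruct (MVT_gen (fun t => Rpower t q * PSeries D (t * x)) t 1
     (fun t => Rpower t (q - 1) * PSeries (fun n => (q + INR n) * D n) (t * x))) as [z [hz e]].
  - intros z hz. rewrite Rmin_left in hz by lra. apply hder; lra.
  - intros z hz. rewrite Rmin_left in hz by lra. apply continuity_pt_filterlim.
    apply (ex_derive_continuous (fun t => Rpower t q * PSeries D (t * x))). eexists. apply hder; lra.
  - replace (Rpower 1 q) with 1 in e by (unfold Rpower; now rewrite ln_1, Rmult_0_r, exp_0).
    rewrite !Rmult_1_l in e.
    assert (0 < Rpower t q * PSeries D (t * x)) by (apply Rmult_lt_0_compat; [apply Rpower_pos|assumption]).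
    assert (0 <= Rpower z (q - 1) * PSeries (fun n => (q + INR n) * D n) (z * x)).
    { apply Rmult_le_pos; [left; apply Rpower_pos|apply h]. }
    nra.
Qed.

Definition D2 (c : nat -> R) : nat -> R := PS_derive (PS_derive c).

(** Positive coefficients supply the condition at 0 of [PSeries_pos_of_euler], by which convexity
    becomes strict after a division. *)
Definition convex_entire (c : nat -> R) : Prop :=
  (forall n, 0 < c n) /\ entire c /\ forall x, 0 <= PSeries (D2 c) x.

Lemma PSeries_D2_dilate c r x : PSeries (D2 (fun n => c n * r ^ n)) x = r ^ 2 * PSeries (D2 c) (r * x).
Proof.
  rewrite <- PSeries_dilate. apply PSeries_scal_ext. intros n.
  unfold D2, PS_derive. simpl pow. ring.
Qed.

Lemma convex_entire_dilate c r : 0 < r -> convex_entire c -> convex_entire (fun n => c n * r ^ n).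
Proof.
  intros hr (h1 & h2 & h3). repeat split.
  - intros n. apply Rmult_lt_0_compat; [apply h1|now apply pow_lt].
  - now apply entire_dilate.
  - intros x. rewrite PSeries_D2_dilate. apply Rmult_le_pos; [apply pow_le; lra|apply h3].
Qed.

Lemma convex_entire_comb c d k l : 0 < k -> 0 < l -> convex_entire c -> convex_entire d ->
  convex_entire (fun n => k * c n + l * d n).
Proof.
  intros hk hl (h1 & h2 & h3) (h1' & h2' & h3'). repeat split.
  - intros n. specialize (h1 n). specialize (h1' n). nra.
  - intros x. apply (ex_series_le (V := R_CompleteNormedModule) _
      (fun n => k * Rabs (c n * x ^ n) + l * Rabs (d n * x ^ n))).
    + intros n. unfold norm; simpl; unfold abs; simpl. rewrite Rabs_Rabsolu.
      replace ((k * c n + l * d n) * x ^ n) with (k * (c n * x ^ n) + l * (d n * x ^ n)) by ring.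
      apply Rle_trans with (1 := Rabs_triang _ _).
      rewrite (Rabs_mult k), (Rabs_mult l), (Rabs_right k), (Rabs_right l) by lra. lra.
    + apply (ex_series_plus (V := R_NormedModule)); apply (ex_series_scal_l (V := R_NormedModule)).
      apply h2. apply h2'.
  - intros x.
    rewrite (PSeries_ext _ (PS_plus (PS_scal k (D2 c)) (PS_scal l (D2 d)))).
    + rewrite PSeries_plus.
      * rewrite !PSeries_scal. specialize (h3 x). specialize (h3' x). nra.
      * apply ex_pseries_scal; [apply Rmult_comm|]. now apply entire_ex_pseries, entire_derive, entire_derive.
      * apply ex_pseries_scal; [apply Rmult_comm|]. now apply entire_ex_pseries, entire_derive, entire_derive.
    + intros n. unfold D2, PS_derive, PS_plus, PS_scal, plus, scal; simpl; unfold mult; simpl. ring.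
Qed.

(** With [q = s / a + 2], the shift by 2 coming from the two derivatives, [(q + n)] times the
    coefficients of [D2 d] equals [1 / a] times those of [D2 c], so [PSeries_pos_of_euler]
    applies. *)
Lemma convex_entire_div c a s : 0 < a -> 0 < s -> convex_entire c ->
  let d := fun n => c n / (s + a * INR n) in
  convex_entire d /\ forall x, 0 < PSeries (D2 d) x.
Proof.
  intros ha hs (h1 & h2 & h3) d.
  assert (hp : forall n, s <= s + a * INR n) by (intros n; assert (h := pos_INR n); nra).
  assert (hd : forall n, 0 < d n).
  { intros n. apply Rdiv_lt_0_compat; [apply h1|]. specialize (hp n). lra. }
  assert (he : entire d).
  { apply entire_le with (1 := h2) (K := / s). intros n. specialize (hp n).
    rewrite !Rabs_right by (apply Rle_ge; left; auto). unfold d, Rdiv. rewrite Rmult_comm.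
    apply Rmult_le_compat_r; [left; apply h1|]. apply Rinv_le_contravar; lra. }
  assert (hpos : forall x, 0 < PSeries (D2 d) x).
  { apply (PSeries_pos_of_euler (D2 d) (s / a + 2)).
    - assert (0 < s / a) by now apply Rdiv_lt_0_compat. lra.
    - now apply entire_derive, entire_derive.
    - unfold D2, PS_derive. specialize (hd 2%nat). simpl INR. lra.
    - intros x. rewrite (PSeries_scal_ext (D2 c) _ (/ a)).
      + apply Rmult_le_pos; [left; now apply Rinv_0_lt_compat|apply h3].
      + intros n. unfold D2, PS_derive, d. specialize (hp (S (S n))).
        rewrite !S_INR in *. field. lra. }
  repeat split; auto. intros x. left. apply hpos.
Qed.

(** * Replacing one factor of the coefficients *)

Definition phi (a s : R) (n : nat) : R := (s + a * INR n) / s * (s / (s + a)) ^ n.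

Lemma phi_pos a s n : 0 < a -> 0 < s -> 0 < phi a s n.
Proof.
  intros ha hs. assert (h := pos_INR n).
  apply Rmult_lt_0_compat; [apply Rdiv_lt_0_compat; nra|apply pow_lt, Rdiv_lt_0_compat; lra].
Qed.

(* With [rho = s / (s + a)], the multiplier [phi a s] sends a power series [h] to the value at [x] of
   the tangent of [h] at [rho x]. *)
Lemma PSeries_phi h a s x : entire h -> 0 < a -> 0 < s ->
  let rho := s / (s + a) in
  PSeries (fun n => h n * phi a s n) x
  = PSeries h (rho * x) + (1 - rho) * (x * PSeries (PS_derive h) (rho * x)).
Proof.
  intros he ha hs rho.
  rewrite (PSeries_ext _ (fun n => ((s + a * INR n) / s * h n) * rho ^ n))
    by (intros n; unfold phi; fold rho; ring).
  rewrite PSeries_dilate.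
  rewrite (PSeries_scal_ext (fun n => (s / a + INR n) * h n) _ (a / s)) by (intros n; field; lra).
  rewrite PSeries_euler by assumption. unfold rho. field. lra.
Qed.

Lemma phi_step c a s1 s2 : 0 < a -> 0 < s1 -> s1 < s2 -> convex_entire c ->
  let d := fun n => c n / phi a s1 n * phi a s2 n in
  convex_entire d /\ forall x, x <> 0 -> PSeries c x < PSeries d x.
Proof.
  intros ha hs1 hs hc d.
  set (r1 := s1 / (s1 + a)). set (r2 := s2 / (s2 + a)).
  assert (hr1 : 0 < r1) by (apply Rdiv_lt_0_compat; lra).
  assert (hr2 : 0 < r2) by (apply Rdiv_lt_0_compat; lra).
  assert (hr12 : r1 < r2).
  { unfold r1, r2. apply Rmult_lt_reg_r with ((s1 + a) * (s2 + a)); [nra|].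
    field_simplify; [|lra|lra]. nra. }
  assert (hr21 : r2 < 1).
  { unfold r2. apply Rmult_lt_reg_r with (s2 + a); [lra|]. field_simplify; lra. }
  assert (hpn : forall n, 0 < s1 + a * INR n) by (intros n; assert (h := pos_INR n); nra).
  split.
  - assert (hc' := convex_entire_dilate c (r2 / r1) ltac:(now apply Rdiv_lt_0_compat) hc).
    destruct (convex_entire_div _ a s1 ha hs1 hc') as [hg _].
    assert (hk : 0 < s1 / s2) by (apply Rdiv_lt_0_compat; lra).
    (* Partial fractions: [(s2 + a n) / (s1 + a n) = 1 + (s2 - s1) / (s1 + a n)]. Hence [d] is a
       positive combination of the dilation of [c] by [r2 / r1] and its quotient by [s1 + a n]. *)
    assert (hd := convex_entire_comb _ _ (s1 / s2) (s1 / s2 * (s2 - s1)) hk ltac:(nra) hc' hg).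
    assert (ed : forall n, s1 / s2 * (c n * (r2 / r1) ^ n) +
         s1 / s2 * (s2 - s1) * (c n * (r2 / r1) ^ n / (s1 + a * INR n)) = d n).
    { intros n. unfold d, phi. fold r1 r2. specialize (hpn n).
      assert (hq := pow_lt r1 n hr1).
      replace ((r2 / r1) ^ n) with (r2 ^ n / r1 ^ n)
        by (unfold Rdiv; now rewrite Rpow_mult_distr, pow_inv).
      field. lra. }
    destruct hd as (h1 & h2 & h3). repeat split.
    + intros n. rewrite <- ed. apply h1.
    + intros x. apply ex_series_ext with (2 := h2 x). intros n. now rewrite <- ed.
    + intros x. specialize (h3 x).
      rewrite (PSeries_ext _ (D2 d)) in h3; [exact h3|].
      intros n. unfold D2, PS_derive. now rewrite ed.
  - intros x hx.
    set (h := fun n => c n / phi a s1 n).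
    assert (hc' := convex_entire_dilate c (/ r1) ltac:(now apply Rinv_0_lt_compat) hc).
    destruct (convex_entire_div _ a s1 ha hs1 hc') as [(_ & hg & _) hg2].
    set (g := fun n => c n * (/ r1) ^ n / (s1 + a * INR n)) in *.
    assert (eh : forall n, h n = s1 * g n).
    { intros n. unfold h, g, phi. fold r1. specialize (hpn n). assert (hq := pow_lt r1 n hr1).
      rewrite pow_inv. field. lra. }
    assert (he : entire h).
    { apply entire_le with (1 := hg) (K := s1). intros n. rewrite eh, Rabs_mult, (Rabs_right s1); lra. }
    assert (hh : forall y, 0 < PSeries (D2 h) y).
    { intros y. rewrite (PSeries_scal_ext (D2 g) _ s1).
      - apply Rmult_lt_0_compat; [assumption|apply hg2].
      - intros n. unfold D2, PS_derive. rewrite eh. ring. }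
    (* [H r] is the value at [x] of the tangent to [h] at [r x]. Its derivative
       [(1 - r) x^2 h''(r x)] is positive for [r < 1], because [h] is strictly convex and [x]
       nonzero. *)
    set (H := fun r => PSeries h (r * x) + (1 - r) * (x * PSeries (PS_derive h) (r * x))).
    set (H' := fun r => (1 - r) * (x * (x * PSeries (D2 h) (r * x)))).
    assert (hH : forall r, is_derive H r (H' r)).
    { intros r. unfold H, H'.
      replace ((1 - r) * (x * (x * PSeries (D2 h) (r * x)))) with
        (x * PSeries (PS_derive h) (r * x) + ((- (1)) * (x * PSeries (PS_derive h) (r * x))
         + (1 - r) * (x * (x * PSeries (D2 h) (r * x))))) by ring.
      apply (is_derive_plus (fun r => PSeries h (r * x))).
      - now apply is_derive_PSeries_comp.
      - apply (is_derive_mult (fun r => 1 - r) (fun r => x * PSeries (PS_derive h) (r * x))).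
        + auto_derive; [exact I|ring].
        + apply (is_derive_scal (fun r => PSeries (PS_derive h) (r * x))).
          apply is_derive_PSeries_comp. now apply entire_derive.
        + intros; apply Rmult_comm. }
    rewrite (PSeries_ext c (fun n => h n * phi a s1 n)).
    2: { intros n. unfold h. assert (hp := phi_pos a s1 n ha hs1). field. lra. }
    change (PSeries d x) with (PSeries (fun n => h n * phi a s2 n) x).
    rewrite !PSeries_phi by (assumption || lra). fold r1 r2. fold (H r1) (H r2).
    destruct (MVT_gen H r1 r2 H') as [z [hz e]].
    + intros; apply hH.
    + intros z hz. apply continuity_pt_filterlim, (ex_derive_continuous H). eexists; apply hH.
    + rewrite Rmin_left, Rmax_right in hz by lra.
      assert (0 < H' z).
      { unfold H'. rewrite <- Rmult_assoc with (r1 := x).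
        apply Rmult_lt_0_compat; [lra|]. apply Rmult_lt_0_compat; [nra|apply hh]. }
      nra.
Qed.

(** In the variable [z = a / s] the factor is [(1 + n z) / (1 + z)^n], which decreases in [z]; the
    cross-multiplied inequality is proved by induction on [n]. *)
Lemma phi_mono a s1 s2 n : 0 < a -> 0 < s1 -> s1 <= s2 -> phi a s1 n <= phi a s2 n.
Proof.
  intros ha h1 h2.
  assert (e : forall s, 0 < s -> phi a s n = (1 + INR n * (a / s)) / (1 + a / s) ^ n).
  { intros s hs. unfold phi. replace (s / (s + a)) with (/ (1 + a / s)) by (field; lra).
    rewrite pow_inv. unfold Rdiv at 3. f_equal. field. lra. }
  rewrite !e by lra.
  set (z1 := a / s1). set (z2 := a / s2).
  assert (hz2 : 0 < z2) by (apply Rdiv_lt_0_compat; lra).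
  assert (hz : z2 <= z1).
  { apply Rmult_le_compat_l; [lra|]. apply Rinv_le_contravar; lra. }
  assert (hp1 : 0 < (1 + z1) ^ n) by (apply pow_lt; lra).
  assert (hp2 : 0 < (1 + z2) ^ n) by (apply pow_lt; lra).
  enough (hm : (1 + INR n * z1) * (1 + z2) ^ n <= (1 + INR n * z2) * (1 + z1) ^ n).
  { apply Rmult_le_reg_r with ((1 + z1) ^ n * (1 + z2) ^ n); [nra|].
    field_simplify; lra. }
  clear e hp1 hp2. induction n as [|n IH]; [simpl; lra|].
  rewrite S_INR. simpl pow.
  assert (hn := pos_INR n).
  set (A := 1 + INR n * z1) in *. set (B := 1 + INR n * z2) in *.
  assert (hA : 1 <= A) by (unfold A; nra). assert (hB : 1 <= B) by (unfold B; nra).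
  assert (hp1 : 0 < (1 + z1) ^ n) by (apply pow_lt; lra).
  set (P1 := (1 + z1) ^ n) in *. set (P2 := (1 + z2) ^ n) in *.
  replace (1 + (INR n + 1) * z1) with (A + z1) by (unfold A; ring).
  replace (1 + (INR n + 1) * z2) with (B + z2) by (unfold B; ring).
  (* Multiplying by [A] makes [A * P2], the left side of the induction hypothesis, appear. What
     remains is a polynomial inequality whose difference has the factor [z1 - z2]. *)
  apply Rmult_le_reg_l with A; [lra|].
  apply Rle_trans with ((A + z1) * (1 + z2) * (B * P1)).
  - replace (A * ((A + z1) * ((1 + z2) * P2))) with ((A + z1) * (1 + z2) * (A * P2)) by ring.
    apply Rmult_le_compat_l; [nra|exact IH].
  - replace ((A + z1) * (1 + z2) * (B * P1)) with (((A + z1) * (1 + z2) * B) * P1) by ring.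
    replace (A * ((B + z2) * ((1 + z1) * P1))) with ((A * (B + z2) * (1 + z1)) * P1) by ring.
    apply Rmult_le_compat_r; [lra|].
    assert (ed : A * (B + z2) * (1 + z1) - (A + z1) * (1 + z2) * B
      = (z1 - z2) * (z1 * z2 * INR n + (A * B - 1))) by (unfold A, B; ring).
    assert (0 <= (z1 - z2) * (z1 * z2 * INR n + (A * B - 1))); [|lra].
    apply Rmult_le_pos; [lra|]. apply Rplus_le_le_0_compat; [|nra].
    apply Rmult_le_pos; [nra|assumption].
Qed.

(** * The normalised Mittag-Leffler series *)

Definition ML_coef (a b : R) (n : nat) : R :=
  Gamma b / Gamma (b + a * INR n) * (Gamma (b + a) / Gamma b) ^ n.

Lemma ML_coef_pos a b n : 0 < a -> 0 < b -> 0 < ML_coef a b n.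
Proof.
  intros ha hb. assert (hn := pos_INR n).
  apply Rmult_lt_0_compat; [|apply pow_lt]; apply Rdiv_lt_0_compat; apply Gamma_pos; nra.
Qed.

Lemma ML_coef_0 a b : 0 < b -> ML_coef a b 0 = 1.
Proof.
  intros hb. unfold ML_coef. simpl INR. rewrite Rmult_0_r, Rplus_0_r. simpl.
  assert (h := Gamma_pos b hb). field. lra.
Qed.

Lemma ML_coef_phi a b n : 0 < a -> 0 < b -> ML_coef a b n = phi a b n * ML_coef a (b + 1) n.
Proof.
  intros ha hb. assert (hn := pos_INR n). unfold ML_coef, phi.
  replace (b + 1 + a * INR n) with (b + a * INR n + 1) by ring.
  replace (b + 1 + a) with (b + a + 1) by ring.
  rewrite !Gamma_succ by nra.
  assert (g1 := Gamma_pos b hb). assert (g2 := Gamma_pos (b + a) ltac:(lra)).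
  assert (g3 := Gamma_pos (b + a * INR n) ltac:(nra)).
  replace ((b + a) * Gamma (b + a) / (b * Gamma b)) with ((/ (b / (b + a))) * (Gamma (b + a) / Gamma b))
    by (field; lra).
  rewrite Rpow_mult_distr, pow_inv.
  assert (hp : 0 < (b / (b + a)) ^ n) by (apply pow_lt, Rdiv_lt_0_compat; lra).
  assert (0 < b + a * INR n) by nra.
  field. lra.
Qed.

Lemma lim_ratio_affine p q :
  filterlim (fun b => (b + p) / (b + q)) (Rbar_locally p_infty) (locally 1).
Proof.
  apply filterlim_locally. intros eps. assert (he := cond_pos eps).
  assert (hd : 0 <= Rabs (p - q) / eps) by (apply Rdiv_le_0_compat; [apply Rabs_pos|lra]).
  exists (Rabs (p - q) / eps - q). intros b hb.
  assert (hbq : Rabs (p - q) / eps < b + q) by lra.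
  change (Rabs ((b + p) / (b + q) - 1) < eps).
  replace ((b + p) / (b + q) - 1) with ((p - q) / (b + q)) by (field; lra).
  unfold Rdiv. rewrite Rabs_mult, Rabs_inv, (Rabs_right (b + q)) by lra.
  apply (Rmult_lt_compat_r eps) in hbq; [|lra].
  unfold Rdiv in hbq. rewrite Rmult_assoc, Rinv_l, Rmult_1_r in hbq by lra.
  apply Rmult_lt_reg_r with (b + q); [lra|].
  rewrite Rmult_assoc, Rinv_l by lra. lra.
Qed.

(** With [k = a n], the two Gamma ratio bounds enclose [Gamma b / Gamma (b + k)] between
    [(b + k)^(-k)] and [(b - 1)^(-k)], and the remaining power between [(b - 1)^k] and
    [(b + a)^k]. *)
Lemma ML_coef_lim a n : 0 < a -> filterlim (fun b => ML_coef a b n) (Rbar_locally p_infty) (locally 1).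
Proof.
  intros ha. destruct n as [|n].
  - apply (filterlim_ext_loc (fun _ => 1)); [|apply filterlim_const].
    exists 0. intros b hb. symmetry. now apply ML_coef_0.
  - set (k := a * INR (S n)).
    assert (hk : 0 < k) by (apply Rmult_lt_0_compat; [lra|apply lt_0_INR; lia]).
    apply (filterlim_le_le (F := Rbar_locally p_infty)
      (fun b => Rpower ((b + - (1)) / (b + k)) k) _ (fun b => Rpower ((b + a) / (b + - (1))) k) 1).
    + exists 1. intros b hb.
      assert (g1 := Gamma_pos b ltac:(lra)). assert (g2 := Gamma_pos (b + k) ltac:(lra)).
      assert (l1 := Gamma_ratio_lower b k hb hk). assert (u1 := Gamma_ratio_upper b k ltac:(lra) hk).
      assert (l2 := Gamma_ratio_lower b a hb ha). assert (u2 := Gamma_ratio_upper b a ltac:(lra) ha).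
      assert (hpow : forall x, 0 < x -> Rpower x k = (Rpower x a) ^ (S n)).
      { intros x hx. rewrite <- Rpower_pow, Rpower_mult by apply Rpower_pos. reflexivity. }
      rewrite !Rpower_div by lra. fold (Rminus b 1).
      assert (hq1 : Rpower (b - 1) k <= (Gamma (b + a) / Gamma b) ^ S n).
      { rewrite hpow by lra. apply pow_incr. split; [left; apply Rpower_pos|].
        apply Rmult_le_reg_r with (Gamma b); [assumption|].
        unfold Rdiv. rewrite Rmult_assoc, Rinv_l by lra. lra. }
      assert (hq2 : (Gamma (b + a) / Gamma b) ^ S n <= Rpower (b + a) k).
      { rewrite hpow by lra. apply pow_incr.
        split; [left; apply Rdiv_lt_0_compat; [apply Gamma_pos; lra|assumption]|].
        apply Rmult_le_reg_r with (Gamma b); [assumption|].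
        unfold Rdiv. rewrite Rmult_assoc, Rinv_l by lra. lra. }
      unfold ML_coef. fold k.
      assert (p1 := Rpower_pos (b - 1) k). assert (p2 := Rpower_pos (b + k) k).
      assert (hr1 : / Rpower (b + k) k <= Gamma b / Gamma (b + k)).
      { apply Rmult_le_reg_r with (Gamma (b + k)); [assumption|].
        unfold Rdiv. rewrite Rmult_assoc, Rinv_l by lra.
        apply Rmult_le_reg_l with (1 := p2).
        rewrite <- (Rmult_assoc _ (/ _)), Rinv_r by lra. lra. }
      assert (hr2 : Gamma b / Gamma (b + k) <= / Rpower (b - 1) k).
      { apply Rmult_le_reg_r with (Gamma (b + k)); [assumption|].
        unfold Rdiv. rewrite Rmult_assoc, Rinv_l by lra.
        apply Rmult_le_reg_l with (1 := p1).
        rewrite <- (Rmult_assoc _ (/ _)), Rinv_r by lra. lra. }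
      unfold Rdiv at 1 6. rewrite (Rmult_comm (Rpower (b - 1) k)), (Rmult_comm (Rpower (b + a) k)).
      split; apply Rmult_le_compat; try assumption;
        left; try assumption; try (now apply Rinv_0_lt_compat); try (now apply Rdiv_lt_0_compat).
      apply Rlt_le_trans with (2 := hq1). assumption.
    + apply (filterlim_Rpower_1 (Rbar_locally p_infty)). apply lim_ratio_affine.
    + apply (filterlim_Rpower_1 (Rbar_locally p_infty)). apply lim_ratio_affine.
Qed.

Lemma ML_coef_lim_seq a b n : 0 < a -> is_lim_seq (fun k => ML_coef a (b + INR k) n) 1.
Proof.
  intros ha.
  apply (filterlim_comp _ _ _ (fun k => b + INR k) (fun b => ML_coef a b n) _ (Rbar_locally p_infty));
    [|now apply ML_coef_lim].
  apply (is_lim_seq_ext (fun k => b + 1 * INR k)); [intros; ring|].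
  apply is_lim_seq_affine_p, Rlt_0_1.
Qed.

(** The coefficient of [b1] after its first [k] factors [phi] have been replaced by those of [b2]:
    the quotient of the outer terms is the product of [phi a (b2 + i) n] over [i < k]. *)
Definition ML_coef_mix (a b1 b2 : R) (k n : nat) : R :=
  ML_coef a b2 n * ML_coef a (b1 + INR k) n / ML_coef a (b2 + INR k) n.

Lemma ML_coef_mix_0 a b1 b2 n : 0 < a -> 0 < b2 -> ML_coef_mix a b1 b2 0 n = ML_coef a b1 n.
Proof.
  intros ha hb. unfold ML_coef_mix. simpl INR. rewrite !Rplus_0_r.
  assert (h := ML_coef_pos a b2 n ha hb). field. lra.
Qed.

Lemma ML_coef_mix_S a b1 b2 k n : 0 < a -> 0 < b1 -> 0 < b2 ->
  ML_coef_mix a b1 b2 (S k) n = ML_coef_mix a b1 b2 k n / phi a (b1 + INR k) n * phi a (b2 + INR k) n.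
Proof.
  intros ha h1 h2. assert (hk := pos_INR k). unfold ML_coef_mix. rewrite S_INR, <- !Rplus_assoc.
  rewrite (ML_coef_phi a (b1 + INR k)), (ML_coef_phi a (b2 + INR k)) by lra.
  assert (p1 := phi_pos a (b1 + INR k) n ha ltac:(lra)).
  assert (p2 := phi_pos a (b2 + INR k) n ha ltac:(lra)).
  assert (p3 := ML_coef_pos a (b2 + INR k + 1) n ha ltac:(lra)). field. lra.
Qed.

Lemma ML_coef_mix_lim a b1 b2 n : 0 < a -> is_lim_seq (fun k => ML_coef_mix a b1 b2 k n) (ML_coef a b2 n).
Proof.
  intros ha.
  replace (Finite (ML_coef a b2 n)) with (Finite (ML_coef a b2 n * 1 / 1)) by (f_equal; field).
  apply is_lim_seq_div'; [|now apply ML_coef_lim_seq|lra].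
  apply is_lim_seq_mult'; [apply is_lim_seq_const|now apply ML_coef_lim_seq].
Qed.

(** By [phi_mono] each replacement increases the coefficient; the replacements lead from the
    coefficient of [b1] to that of [b2] in the limit. *)
Lemma ML_coef_incr a b1 b2 n : 0 < a -> 0 < b1 -> b1 <= b2 -> ML_coef a b1 n <= ML_coef a b2 n.
Proof.
  intros ha h1 h2. rewrite <- (ML_coef_mix_0 a b1 b2 n ha ltac:(lra)).
  apply (is_lim_seq_incr_compare (fun k => ML_coef_mix a b1 b2 k n)); [now apply ML_coef_mix_lim|].
  intros k. rewrite ML_coef_mix_S by lra. assert (hk := pos_INR k).
  assert (p1 := phi_pos a (b1 + INR k) n ha ltac:(lra)).
  assert (hp := phi_mono a (b1 + INR k) (b2 + INR k) n ha ltac:(lra) ltac:(lra)).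
  assert (hm : 0 < ML_coef_mix a b1 b2 k n).
  { apply Rdiv_lt_0_compat; [apply Rmult_lt_0_compat|]; apply ML_coef_pos; lra. }
  apply Rmult_le_reg_r with (1 := p1). unfold Rdiv.
  replace (ML_coef_mix a b1 b2 k n * / phi a (b1 + INR k) n * phi a (b2 + INR k) n * phi a (b1 + INR k) n)
    with (ML_coef_mix a b1 b2 k n * phi a (b2 + INR k) n) by (field; lra).
  apply Rmult_le_compat_l; lra.
Qed.

Lemma ML_coef_le_1 a b n : 0 < a -> 0 < b -> ML_coef a b n <= 1.
Proof.
  intros ha hb. replace b with (b + INR 0) by (simpl; ring).
  apply (is_lim_seq_incr_compare (fun k => ML_coef a (b + INR k) n) 1); [now apply ML_coef_lim_seq|].
  intros k. assert (hk := pos_INR k). apply ML_coef_incr; try rewrite S_INR; lra.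
Qed.

Lemma ML_coef_mix_le a b1 b2 k n : 0 < a -> 0 < b1 -> b1 <= b2 -> ML_coef_mix a b1 b2 k n <= ML_coef a b2 n.
Proof.
  intros ha h1 h2. assert (hk := pos_INR k).
  assert (hi := ML_coef_incr a (b1 + INR k) (b2 + INR k) n ha ltac:(lra) ltac:(lra)).
  assert (p := ML_coef_pos a (b2 + INR k) n ha ltac:(lra)).
  assert (p2 := ML_coef_pos a b2 n ha ltac:(lra)).
  apply Rmult_le_reg_r with (1 := p). unfold ML_coef_mix, Rdiv.
  rewrite Rmult_assoc, Rinv_l, Rmult_1_r by lra. apply Rmult_le_compat_l; lra.
Qed.

Lemma rising_bin_1 n : rising_bin 1 n = 1.
Proof.
  induction n as [|n IH]; [reflexivity|].
  assert (h := not_0_INR (S n) ltac:(lia)).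
  apply Rmult_eq_reg_l with (2 := h). rewrite rising_bin_S, IH, S_INR. ring.
Qed.

(** For [m = 2] and [m = 3], [(m-1)! * rising_bin m n] is the multiplier of the derivative of order
    [m - 1]; this connects [ML_deriv_nonneg] with [PS_derive] and [D2]. *)
Lemma rising_bin_2 n : rising_bin 2 n = INR (S n).
Proof.
  assert (h := rising_bin_shift 1 n). rewrite rising_bin_1 in h.
  replace (1 + 1) with 2 in h by ring. lra.
Qed.

Lemma rising_bin_3 n : 2 * rising_bin 3 n = INR (S (S n)) * INR (S n).
Proof.
  assert (h := rising_bin_shift 2 n). rewrite rising_bin_2 in h.
  replace (2 + 1) with 3 in h by ring. lra.
Qed.

Lemma ML_coef_entire a b : 0 < a -> 0 < b -> entire (ML_coef a b).
Proof.
  intros ha hb.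
  assert (h := entire_dilate _ (Gamma (b + a) / Gamma b)
    (CV_radius_entire _ (CV_radius_infinite_Gamma a b 1 ha hb Rlt_0_1))).
  assert (g := Gamma_pos b hb).
  apply entire_le with (1 := h) (K := Gamma b). intros n. right.
  rewrite <- (Rabs_right (Gamma b)) at 1 by lra. rewrite <- Rabs_mult. f_equal.
  rewrite rising_bin_1. unfold ML_coef, Rdiv. ring.
Qed.

(** This is [ML_deriv_nonneg] with [m = 2] and [c = b - a], after the dilation by [q]; the
    assumption [a < b] makes [c] nonnegative. *)
Lemma PSeries_ML_coef_derive_nonneg a b x : 0 < a <= 1 -> a < b -> x <= 0 ->
  0 <= PSeries (PS_derive (ML_coef a b)) x.
Proof.
  intros ha hb hx. set (q := Gamma (b + a) / Gamma b).
  assert (g := Gamma_pos b ltac:(lra)).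
  assert (hq : 0 < q) by (apply Rdiv_lt_0_compat; [apply Gamma_pos; lra|assumption]).
  rewrite (PSeries_scal_ext
    (fun n => rising_bin (INR 2) n / Gamma (b - a + a * INR 2 + a * INR n) * q ^ n) _ (Gamma b * q)).
  - rewrite PSeries_dilate. apply Rmult_le_pos; [nra|].
    replace (q * x) with (- (q * (- x))) by ring.
    apply ML_deriv_nonneg; [assumption|lra|lia|nra].
  - intros n. simpl (INR 2). replace (1 + 1) with 2 by ring.
    unfold PS_derive. rewrite rising_bin_2. unfold ML_coef. fold q.
    replace (b - a + a * 2 + a * INR n) with (b + a * INR (S n)) by (rewrite S_INR; ring).
    simpl pow. unfold Rdiv. ring.
Qed.

Lemma ML_coef_convex_entire a b : 0 < a <= 1 -> a < b -> convex_entire (ML_coef a b).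
Proof.
  intros ha hb. set (q := Gamma (b + a) / Gamma b).
  assert (g := Gamma_pos b ltac:(lra)).
  assert (hq : 0 < q) by (apply Rdiv_lt_0_compat; [apply Gamma_pos; lra|assumption]).
  repeat split; [intros; apply ML_coef_pos; lra|apply ML_coef_entire; lra|]. intros x.
  destruct (Rle_lt_dec 0 x) as [hx|hx].
  - apply PSeries_nonneg; [|apply entire_derive, entire_derive, ML_coef_entire; lra|assumption].
    intros n. unfold D2, PS_derive. assert (h := ML_coef_pos a b (S (S n)) ltac:(lra) ltac:(lra)).
    assert (h1 := pos_INR (S n)). assert (h2 := pos_INR (S (S n))).
    apply Rmult_le_pos; [assumption|]. apply Rmult_le_pos; lra.
  (* On the negative half-line, [ML_deriv_nonneg] with [m = 3] and [c = b - a]: indeed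
     [c + 3 a + a n = b + a (n + 2)]. *)
  - rewrite (PSeries_scal_ext
      (fun n => rising_bin (INR 3) n / Gamma (b - a + a * INR 3 + a * INR n) * q ^ n) _ (2 * Gamma b * q ^ 2)).
    + rewrite PSeries_dilate. apply Rmult_le_pos; [nra|].
      replace (q * x) with (- (q * (- x))) by ring.
      apply ML_deriv_nonneg; [assumption|lra|lia|nra].
    + intros n. simpl (INR 3). replace (1 + 1 + 1) with 3 by ring.
      unfold D2, PS_derive. rewrite <- Rmult_assoc, (Rmult_comm (INR (S n))), <- rising_bin_3.
      unfold ML_coef. fold q.
      replace (b - a + a * 3 + a * INR n) with (b + a * INR (S (S n))) by (rewrite !S_INR; ring).
      simpl pow. unfold Rdiv. ring.
Qed.

(** * Monotonicity in the second parameter *)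

Lemma PSeries_ML_coef_incr a b1 b2 x : 0 < a <= 1 -> x <> 0 -> a < b1 -> b1 < b2 ->
  PSeries (ML_coef a b1) x < PSeries (ML_coef a b2) x.
Proof.
  intros ha hx h1 h2.
  assert (hc : forall k, convex_entire (ML_coef_mix a b1 b2 k) /\
    PSeries (ML_coef_mix a b1 b2 k) x < PSeries (ML_coef_mix a b1 b2 (S k)) x).
  { assert (hstep : forall k, convex_entire (ML_coef_mix a b1 b2 k) ->
      convex_entire (ML_coef_mix a b1 b2 (S k)) /\
      PSeries (ML_coef_mix a b1 b2 k) x < PSeries (ML_coef_mix a b1 b2 (S k)) x).
    { intros k hk. assert (hi := pos_INR k).
      destruct (phi_step _ a (b1 + INR k) (b2 + INR k) ltac:(lra) ltac:(lra) ltac:(lra) hk)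
        as [(s1 & s2 & s3) s4].
      assert (e : forall n, ML_coef_mix a b1 b2 (S k) n =
        ML_coef_mix a b1 b2 k n / phi a (b1 + INR k) n * phi a (b2 + INR k) n)
        by (intros n; apply ML_coef_mix_S; lra).
      split; [repeat split|].
      - intros n. rewrite e. apply s1.
      - intros y. apply ex_series_ext with (2 := s2 y). intros n. now rewrite <- e.
      - intros y. specialize (s3 y). erewrite PSeries_ext; [exact s3|].
        intros n. unfold D2, PS_derive. now rewrite e.
      - rewrite (PSeries_ext _ _ x e). now apply s4. }
    assert (hall : forall k, convex_entire (ML_coef_mix a b1 b2 k)).
    { induction k as [|k IH]; [|now apply hstep].
      destruct (ML_coef_convex_entire a b1 ha h1) as (s1 & s2 & s3).
      assert (e : forall n, ML_coef_mix a b1 b2 0 n = ML_coef a b1 n) by (intros n; apply ML_coef_mix_0; lra).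
      repeat split.
      - intros n. rewrite e. apply s1.
      - intros y. apply ex_series_ext with (2 := s2 y). intros n. now rewrite <- e.
      - intros y. specialize (s3 y). erewrite PSeries_ext; [exact s3|].
        intros n. unfold D2, PS_derive. now rewrite e. }
    intros k. split; [apply hall|now apply hstep]. }
  (* The strict gain of the first replacement survives the limit, since the later ones never
     decrease the value. *)
  apply Rlt_le_trans with (PSeries (ML_coef_mix a b1 b2 1) x).
  - rewrite (PSeries_ext (ML_coef a b1) (ML_coef_mix a b1 b2 0)).
    + apply hc.
    + intros n. symmetry. apply ML_coef_mix_0; lra.
  - apply (is_lim_seq_incr_compare (fun k => PSeries (ML_coef_mix a b1 b2 k) x)); [|intros k; left; apply hc].
    apply (Series_dominated_lim eventually (fun k n => ML_coef_mix a b1 b2 k n * x ^ n)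
      (fun n => ML_coef a b2 n * x ^ n) (fun n => Rabs (ML_coef a b2 n * x ^ n))).
    + apply ML_coef_entire; lra.
    + exists 0%nat. intros k _ n. rewrite !Rabs_mult. apply Rmult_le_compat_r; [apply Rabs_pos|].
      assert (h3 := ML_coef_mix_le a b1 b2 k n ltac:(lra) ltac:(lra) ltac:(lra)).
      assert (h4 := proj1 (proj1 (hc k)) n).
      rewrite !Rabs_right; lra.
    + intros n. apply Rle_refl.
    + intros n. apply (is_lim_seq_mult' _ (fun _ => x ^ n));
        [apply ML_coef_mix_lim; lra|apply is_lim_seq_const].
Qed.

(** * Limits at infinity *)

Lemma sum_le_Series (u : nat -> R) K : (forall n, 0 <= u n) -> ex_series u -> sum_f_R0 u K <= Series u.
Proof.
  intros hu hex. rewrite (Series_incr_n u (S K) ltac:(lia) hex). simpl Nat.pred.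
  assert (0 <= Series (fun k => u (S K + k)%nat)); [|lra].
  replace 0 with (Series (fun _ => 0 * 0)) by (rewrite Series_scal_l; ring).
  apply Series_le; [|now apply ex_series_incr_n]. intros n. rewrite Rmult_0_l. split; [lra|apply hu].
Qed.

Lemma PSeries_ML_coef_lim_p a x : 0 < a -> 1 <= x ->
  filterlim (fun b => PSeries (ML_coef a b) x) (Rbar_locally p_infty) (Rbar_locally p_infty).
Proof.
  intros ha hx Q [M hM].
  destruct (nfloor_ex (Rabs M) (Rabs_pos M)) as [K [_ hK]].
  (* The sum has [K + 2] terms, each tending to 1. Once within 1 of its limit it exceeds [K + 1],
     hence [M]. *)
  assert (hs : filterlim (fun b => sum_f_R0 (ML_coef a b) (S K)) (Rbar_locally p_infty)
     (locally (sum_f_R0 (fun _ => 1) (S K)))).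
  { apply filterlim_sum_f_R0; [typeclasses eauto|]. intros n. now apply ML_coef_lim. }
  assert (hev := proj1 (filterlim_locally _ _) hs (mkposreal 1 Rlt_0_1)).
  assert (hpos : Rbar_locally p_infty (fun b => 0 < b)) by (exists 0; auto).
  unfold filtermap. generalize (filter_and _ _ hev hpos). apply filter_imp. intros b [h1 hb].
  apply hM. apply Rabs_lt_between in h1. unfold minus, plus, opp in h1; simpl in h1.
  rewrite sum_cte in h1.
  assert (hle : sum_f_R0 (ML_coef a b) (S K) <= PSeries (ML_coef a b) x).
  { apply Rle_trans with (sum_f_R0 (fun n => ML_coef a b n * x ^ n) (S K)).
    - apply sum_Rle. intros n _. assert (hc := ML_coef_pos a b n ha hb). assert (hp := pow_R1_Rle x n hx). nra.
    - apply sum_le_Series; [|now apply entire_ex_series, ML_coef_entire].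
      intros n. apply Rmult_le_pos; [left; now apply ML_coef_pos|apply pow_le; lra]. }
  assert (hMa := Rle_abs M). rewrite !S_INR in h1. simpl in hle, h1. lra.
Qed.

Lemma PSeries_ML_coef_lim_unit a x : 0 < a -> 0 < x < 1 ->
  filterlim (fun b => PSeries (ML_coef a b) x) (Rbar_locally p_infty) (locally (1 / (1 - x))).
Proof.
  intros ha hx.
  replace (1 / (1 - x)) with (Series (fun n => x ^ n)).
  2: { rewrite Series_geom; [field; lra|rewrite Rabs_right; lra]. }
  apply (Series_dominated_lim (Rbar_locally p_infty) (fun b n => ML_coef a b n * x ^ n)
    (fun n => x ^ n) (fun n => x ^ n)).
  - apply ex_series_geom. rewrite Rabs_right; lra.
  - exists 0. intros b hb n. assert (h := ML_coef_pos a b n ha hb). assert (h1 := ML_coef_le_1 a b n ha hb).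
    assert (hp : 0 < x ^ n) by (apply pow_lt; lra).
    rewrite Rabs_right by nra. nra.
  - intros n. rewrite Rabs_right; [lra|]. apply Rle_ge, pow_le; lra.
  - intros n. enough (h : filterlim (fun b => ML_coef a b n * x ^ n) (Rbar_locally p_infty)
      (locally (mult 1 (x ^ n))))
      by (change (mult 1 (x ^ n)) with (1 * x ^ n) in h; rewrite Rmult_1_l in h; exact h).
    apply (filterlim_comp_2 _ _ mult (ML_coef_lim a n ha) (filterlim_const (x ^ n))).
    apply (filterlim_mult (K := R_AbsRing)).
Qed.

(* [E_{a,b}(z) = 1 / Gamma b + z E_{a,b+a}(z)], after normalisation. *)
Lemma PSeries_ML_coef_rec a b x : 0 < a -> 0 < b ->
  PSeries (ML_coef a b) x = 1 + x * PSeries (ML_coef a (b + a)) (ML_coef a b 2 * x).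
Proof.
  intros ha hb. unfold PSeries at 1.
  rewrite Series_incr_1 by now apply entire_ex_series, ML_coef_entire.
  rewrite ML_coef_0, pow_O, Rmult_1_r by assumption. f_equal.
  rewrite <- PSeries_dilate. unfold PSeries. rewrite <- Series_scal_l.
  apply Series_ext. intros n. unfold ML_coef.
  assert (hn := pos_INR n).
  replace (b + a * INR 2) with (b + a + a) by (simpl; ring).
  replace (b + a * INR (S n)) with (b + a + a * INR n) by (rewrite S_INR; ring).
  assert (g1 := Gamma_pos b hb). assert (g2 := Gamma_pos (b + a) ltac:(lra)).
  assert (g3 := Gamma_pos (b + a + a) ltac:(lra)).
  assert (g4 := Gamma_pos (b + a + a * INR n) ltac:(nra)).
  replace (Gamma (b + a) / Gamma (b + a + a * INR n) * (Gamma (b + a + a) / Gamma (b + a)) ^ n *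
    (Gamma b / Gamma (b + a + a) * (Gamma (b + a) / Gamma b) ^ 2) ^ n) with
    (Gamma (b + a) / Gamma (b + a + a * INR n) * ((Gamma (b + a + a) / Gamma (b + a)) *
    (Gamma b / Gamma (b + a + a) * (Gamma (b + a) / Gamma b) ^ 2)) ^ n)
    by (rewrite Rpow_mult_distr; ring).
  replace ((Gamma (b + a + a) / Gamma (b + a)) *
    (Gamma b / Gamma (b + a + a) * (Gamma (b + a) / Gamma b) ^ 2)) with (Gamma (b + a) / Gamma b)
    by (field; lra).
  simpl pow. field. lra.
Qed.

Lemma PSeries_ML_coef_mono_neg a b x y : 0 < a <= 1 -> a < b -> x <= y -> y <= 0 ->
  PSeries (ML_coef a b) x <= PSeries (ML_coef a b) y.
Proof.
  intros ha hb hxy hy.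
  assert (he := ML_coef_entire a b ltac:(lra) ltac:(lra)).
  destruct (MVT_gen (PSeries (ML_coef a b)) x y (PSeries (PS_derive (ML_coef a b)))) as [z [hz e]].
  - intros z _. now apply is_derive_PSeries, entire_lt.
  - intros z _. now apply PSeries_continuity, entire_lt.
  - rewrite Rmin_left, Rmax_right in hz by lra.
    assert (h := PSeries_ML_coef_derive_nonneg a b z ha hb ltac:(lra)). nra.
Qed.

(** Write [F(b, x)] for the series and [r = ML_coef a b 2]. As [x <= r x <= 0],
    [F(b + a, r x) >= F(b + a, x) >= F(b, x)]; the recurrence then gives
    [F(b, x) <= 1 + x F(b, x)]. *)
Lemma PSeries_ML_coef_upper_neg a b x : 0 < a <= 1 -> a < b -> x < 0 ->
  PSeries (ML_coef a b) x <= 1 / (1 - x).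
Proof.
  intros ha hb hx.
  assert (r0 := ML_coef_pos a b 2 ltac:(lra) ltac:(lra)). assert (r1 := ML_coef_le_1 a b 2 ltac:(lra) ltac:(lra)).
  assert (e := PSeries_ML_coef_rec a b x ltac:(lra) ltac:(lra)).
  assert (h1 := PSeries_ML_coef_mono_neg a (b + a) x (ML_coef a b 2 * x) ha ltac:(lra) ltac:(nra) ltac:(nra)).
  assert (h2 := PSeries_ML_coef_incr a b (b + a) x ha ltac:(lra) hb ltac:(lra)).
  apply Rmult_le_reg_r with (1 - x); [lra|].
  replace (1 / (1 - x) * (1 - x)) with 1 by (field; lra). nra.
Qed.

(** The recurrence at [z = x / r] has [F(b + a, x)] on its right. Since [z <= x],
    [F(b, z) <= F(b, x) <= F(b + a, x)], whence [1 + z F(b + a, x) <= F(b + a, x)]. *)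
Lemma PSeries_ML_coef_lower_neg a b x : 0 < a <= 1 -> a < b -> x < 0 ->
  1 / (1 - x / ML_coef a b 2) <= PSeries (ML_coef a (b + a)) x.
Proof.
  intros ha hb hx.
  assert (r0 := ML_coef_pos a b 2 ltac:(lra) ltac:(lra)). assert (r1 := ML_coef_le_1 a b 2 ltac:(lra) ltac:(lra)).
  set (r := ML_coef a b 2) in *. set (z := x / r).
  assert (hz : r * z = x) by (unfold z; field; lra).
  assert (e := PSeries_ML_coef_rec a b z ltac:(lra) ltac:(lra)). fold r in e. rewrite hz in e.
  assert (hz0 : z < 0) by nra. assert (hzx : z <= x) by nra.
  assert (h1 := PSeries_ML_coef_mono_neg a b z x ha hb hzx ltac:(lra)).
  assert (h2 := PSeries_ML_coef_incr a b (b + a) x ha ltac:(lra) hb ltac:(lra)).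
  apply Rmult_le_reg_r with (1 - z); [lra|].
  replace (1 / (1 - z) * (1 - z)) with 1 by (field; lra). nra.
Qed.

Lemma PSeries_ML_coef_lim_neg a x : 0 < a <= 1 -> x < 0 ->
  filterlim (fun b => PSeries (ML_coef a b) x) (Rbar_locally p_infty) (locally (1 / (1 - x))).
Proof.
  intros ha hx.
  apply (filterlim_le_le (F := Rbar_locally p_infty) (fun b => 1 / (1 - x / ML_coef a (b - a) 2)) _
    (fun _ => 1 / (1 - x)) (1 / (1 - x))).
  (* For [b > 2 a] the lower bound applies at [b - a], which still exceeds [a]. *)
  - exists (2 * a). intros b hb. split; [|apply PSeries_ML_coef_upper_neg; lra].
    replace b with (b - a + a) at 2 by ring. apply PSeries_ML_coef_lower_neg; lra.
  - apply (filterlim_comp _ _ _ (fun b => ML_coef a (b - a) 2) (fun r => 1 / (1 - x / r)) _ (locally 1)).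
    + apply (filterlim_comp _ _ _ (fun b => b - a) (fun b => ML_coef a b 2) _ (Rbar_locally p_infty));
        [|apply ML_coef_lim; lra].
      intros Q [M hM]. exists (M + a). intros y hy. apply hM. lra.
    + replace (1 / (1 - x)) with (1 / (1 - x / 1)) by (field; lra).
      apply (ex_derive_continuous (fun r => 1 / (1 - x / r))). auto_derive.
      repeat split; lra.
  - apply filterlim_const.
Qed.

Lemma ML_ML_coef a b x : 0 < a -> 0 < b ->
  Gamma b * ML a b (Gamma (b + a) / Gamma b * x) = PSeries (ML_coef a b) x.
Proof.
  intros ha hb. unfold ML. rewrite <- Series_scal_l. apply Series_ext. intros n.
  unfold ML_coef, Rdiv. rewrite Rpow_mult_distr. ring.
Qed.

Theorem theoremD (a x : R) (ha : 0 < a <= 1) (hx : x <> 0) :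
  let F := fun b : R => Gamma b * ML a b (Gamma (b + a) / Gamma b * x) in
  (forall b1 b2 : R, a < b1 -> b1 < b2 -> F b1 < F b2) /\
  (1 <= x -> is_lim F p_infty p_infty) /\
  (x < 1 -> is_lim F p_infty (1 / (1 - x))).
Proof.
  intros F.
  assert (hF : Rbar_locally p_infty (fun b => PSeries (ML_coef a b) x = F b)).
  { exists 0. intros b hb. unfold F. rewrite ML_ML_coef by lra. reflexivity. }
  repeat split.
  - intros b1 b2 h1 h2. unfold F. rewrite (ML_ML_coef a b1), (ML_ML_coef a b2) by lra. now apply PSeries_ML_coef_incr.
  - intros h. apply (filterlim_ext_loc _ _ hF). apply PSeries_ML_coef_lim_p; lra.
  - intros h. apply (filterlim_ext_loc _ _ hF).
    destruct (Rle_lt_dec x 0) as [h0|h0].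
    + apply PSeries_ML_coef_lim_neg; lra.
    + apply PSeries_ML_coef_lim_unit; lra.
Qed.
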